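(* Let $n\ge 1$ be an integer, let $\rho\ge 1$ be real, and let $P(z)=\sum_{j=0}^{n}a_jz^j$ be a polynomial of degree $n$ with complex coefficients which does not vanish in $|z|<\rho$. Then for every $p$ with $0\le p<\infty$ and every $s\in\{0,1,\ldots,n-1\}$, $$\left\|a_nz+\frac{a_s}{\binom{n}{s}}\right\|_p\leq c_p\,\frac{\left\|1+z\right\|_p}{\left\|\rho^s+z\right\|_p}\left\|P\right\|_p,$$ where $c_p=1$ if $s=0$ and $c_p=\dfrac{1}{\|1+z\|_p}$ if $s>0$. Moreover, if $a_j=0$ for $j=1,2,\ldots,n-1$ and $s=0$, then equality holds in this inequality.
   Context: For a polynomial $Q$ with complex coefficients, define $$\|Q\|_p:=\left(\frac{1}{2\pi}\int_{0}^{2\pi}|Q(e^{i\theta})|^p\,d\theta\right)^{1/p}\quad(0<p<\infty),\qquad \|Q\|_0:=\exp\left(\frac{1}{2\pi}\int_{0}^{2\pi}\log|Q(e^{i\theta})|\,d\theta\right).$$ Expressions such as $\|1+z\|_p$, $\|\rho^s+z\|_p$ and $\|a_nz+b\|_p$ denote this quantity for the indicated polynomial in the variable $z$. *)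

(* Defs.v *)
From HB Require Import structures.
From mathcomp Require Import all_boot all_order all_algebra.
From mathcomp Require Import complex.
From mathcomp Require Import all_classical all_reals all_analysis.

Set Implicit Arguments.
Unset Strict Implicit.
Unset Printing Implicit Defensive.

Import Order.TTheory GRing.Theory Num.Theory.
Import numFieldNormedType.Exports.

Local Open Scope classical_set_scope.
Local Open Scope ring_scope.

Definition modulus (R : realType) (z : R[i]) : R := ComplexField.Normc.normc z.

Definition expi (R : realType) (t : R) : R[i] := Complex (cos t) (sin t).

(* The mean is extended real valued and lne 0 = -oo, so log 0 is treated as
   -oo when p = 0; in particular pnorm 0 0 = 0. For p < 0 the value of pnorm
   is irrelevant. *)
Definition circle_mean (R : realType) (f : R -> \bar R) : \bar R :=
  (((2 * pi)^-1)%:E *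
     \int[@lebesgue_measure R]_(t in `[0%R, (2 * pi)%R]) f t)%E.

Definition pnorm (R : realType) (p : R) (Q : {poly R[i]}) : R :=
  if p == 0 then
    fine (expeR (circle_mean (fun t => lne (modulus Q.[expi t])%:E)))
  else
    fine (circle_mean (fun t => (modulus Q.[expi t] `^ p)%:E)) `^ p^-1.

Definition cst_c (R : realType) (p : R) (s : nat) : R :=
  if s == 0%N then 1 else 1 / pnorm p (1 + 'X).

(* Main.v *)
Require Import Defs.
From HB Require Import structures.
From mathcomp Require Import all_boot all_order all_algebra.
From mathcomp Require Import complex.
From mathcomp Require Import all_classical all_reals all_analysis.
From mathcomp Require Import measurable_realfun ring lra.

(* With b_j = P_j / C(n, j), let U = sum C(n-s, j) b_j z^j and
   V = sum C(n-s, j) b_(j+s) z^j; V has constant term a_s / C(n, s) and leading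
   term a_n.  Grace's theorem (iterated polar derivatives) shows that U + w V has
   no zero in |z| < rho when |w| < rho^s, hence rho^s |V| <= |U| on the circle.
   For Mahler measures M, Jensen's formula gives M (a_n z + a_0) <= M P and, after
   reflecting the zeros of P out of the disc, M (U + w z^s V) <= M P for |w| = 1,
   for every P.  Both operators commute with adding constants, and
   log (max (|x|, t)) is the mean of log |x + t e^(iu)| while |x|^p is a mixture of
   such truncated logarithms; therefore both inequalities pass from M to every
   ||.||_p (Arestov's argument).  Averaging the second one over w and using
   rho^s |V| <= |U| gives ||V||_p ||rho^s + z||_p <= ||P||_p, and the first one
   applied to V, or to P when s = 0, concludes. *)

Set Implicit Arguments.
Unset Strict Implicit.
Unset Printing Implicit Defensive.

Import Order.TTheory GRing.Theory Num.Theory.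
Import numFieldNormedType.Exports.

Local Open Scope classical_set_scope.
Local Open Scope ring_scope.

(** * Grace's theorem and the Arestov operator *)

Section Grace.
Variable C : numClosedFieldType.
Implicit Types (P : {poly C}) (b : nat -> C) (r z w : C).

(** For p < 1 the triangle inequality fails, so no operator bound can come from Minkowski's
    inequality. Mahler measures avoid this, because Jensen's formula turns a bound on them into a
    statement about zeros. The transfer to p > 0 shifts polynomials by arbitrary constants, which
    destroys the zero-free hypothesis; this is why both Mahler inequalities are needed for every
    polynomial, and why for p > 0 the hypothesis on P enters only through rho^s |V| <= |U|. The
    factor z^s in U + w z^s V keeps the constant coefficient a_0, the only quantity that matters for
    the Mahler measure after reflection. The factor ||rho^s + z||_p comes from the average over w: a
    rotation leaves only the moduli of U and V, and |k + w| increases with k for k >= 1. Powers are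
    mixtures of truncated logarithms for p > 0 only, so for p = 0 the product estimate is read off
    from Jensen's formula and from Grace's theorem at the origin. *)

Definition zero_free r P := forall z, `|z| < r -> P.[z] != 0.

(** * Laguerre's theorem for a disc *)

Lemma disc_identity r z w : r \is Num.real ->
  `|r ^+ 2 - z^* * w| ^+ 2 - (r * `|z - w|) ^+ 2 =
  (r ^+ 2 - `|z| ^+ 2) * (r ^+ 2 - `|w| ^+ 2).
Proof.
move=> rR; rewrite exprMn !normCK !rmorphB /= rmorphXn !rmorphM /= !conjCK.
by rewrite (conj_Creal rR); ring.
Qed.

(** The affine map x -> (r^2 - |z|^2) x + conj(z) sends 1 / (z - w) to (r^2 - conj(z) w) / (z - w),
    and the sign in [disc_identity] decides whether this has modulus at most r. Centring the disc at
    0 turns averaging over the zeros into the triangle inequality. *)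
Lemma pole_disc r z w : `|z| < r -> r <= `|w| ->
  `|(r ^+ 2 - `|z| ^+ 2) / (z - w) + z^*| <= r.
Proof.
move=> zr rw; have r0 : 0 <= r by rewrite ltW// (le_lt_trans _ zr).
have zw : z - w != 0.
  by rewrite subr_eq0; apply: contraTneq (lt_le_trans zr rw) => ->; rewrite ltxx.
have -> : (r ^+ 2 - `|z| ^+ 2) / (z - w) + z^* = (r ^+ 2 - z^* * w) / (z - w).
  by rewrite normCK; field.
rewrite normrM normfV ler_pdivrMr ?normr_gt0//.
rewrite -ler_sqr ?nnegrE ?mulr_ge0// -subr_le0 disc_identity ?ger0_real//.
rewrite mulr_ge0_le0// ?subr_ge0 ?subr_le0 ler_sqr ?nnegrE//.
exact: ltW.
Qed.

(** The opposite sign in [disc_identity]: for a pole inside the disc, the normalised 1 / (z - w)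
    lies strictly outside the disc of [pole_disc]. *)
Lemma disc_strict r z w : `|z| < r -> `|w| < r ->
  r * `|z - w| < `|r ^+ 2 - z^* * w|.
Proof.
move=> zr wr; have r0 : 0 <= r by rewrite ltW// (le_lt_trans _ zr).
rewrite -ltr_sqr ?nnegrE ?mulr_ge0// -subr_gt0 disc_identity ?ger0_real//.
by rewrite mulr_gt0// subr_gt0 ltr_sqr ?nnegrE.
Qed.

(** Q' / Q is the sum of the 1 / (z - w), and each term brings its own conj(z), so [pole_disc]
    applies term by term. Nonvanishing is part of the induction because the quotient is split
    there. *)
Lemma log_deriv_disc r z (ws : seq C) Q : `|z| < r ->
  {in ws, forall w, r <= `|w|} -> Q = \prod_(w <- ws) ('X - w%:P) ->
  Q.[z] != 0 /\
  `|(r ^+ 2 - `|z| ^+ 2) * (Q^`().[z] / Q.[z]) + z^* *+ size ws| <=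
    r *+ size ws.
Proof.
move=> zr; elim: ws Q => [|w ws IH] _ rw ->.
  rewrite big_nil -polyC1 derivC horner0 mul0r mulr0 addr0 normr0 hornerC.
  by rewrite oner_neq0.
have [|//|Q0 IHQ] := IH (\prod_(w <- ws) ('X - w%:P)).
  by move=> x xs; apply: rw; rewrite inE xs orbT.
rewrite big_cons; set Q := \prod_(_ <- _) _ in Q0 IHQ *.
have rlew : r <= `|w| by apply: rw; rewrite inE eqxx.
have zw : z - w != 0.
  by rewrite subr_eq0; apply: contraTneq (lt_le_trans zr rlew) => ->; rewrite ltxx.
split; first by rewrite hornerM hornerXsubC mulf_neq0.
rewrite derivM derivXsubC mul1r hornerD !hornerM hornerXsubC.
have -> : (Q.[z] + (z - w) * Q^`().[z]) / ((z - w) * Q.[z]) =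
   (z - w)^-1 + Q^`().[z] / Q.[z] by field; rewrite Q0.
rewrite mulrDr 2!mulrS addrACA (le_trans (ler_normD _ _))// lerD//.
exact: pole_disc.
Qed.

(* Laguerre's theorem on polar derivatives: the mean of the values 1 / (z - w)
   over the n zeros, infinite ones included, stays in a disc that does not
   contain 1 / (z - zeta) for zeta in |zeta| < r. *)
Lemma laguerre n P r z zeta : (size P <= n.+2)%N -> zero_free r P ->
  `|z| < r -> `|zeta| < r -> P.[z] *+ n.+1 + (zeta - z) * P^`().[z] != 0.
Proof.
move=> sP zfP zr zetar; have r0 : 0 < r by rewrite (le_lt_trans _ zr).
have P0 : P != 0.
  by apply/eqP => P0; have := zfP _ zr; rewrite P0 horner0 eqxx.
have [ws PE] := closed_field_poly_normal P.
have lP0 : lead_coef P != 0 by rewrite lead_coef_eq0.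
have sws : (size ws <= n.+1)%N.
  by rewrite -ltnS (leq_trans _ sP)// PE size_scale// size_prod_XsubC.
have wsr : {in ws, forall w, r <= `|w|}.
  move=> w wws; rewrite real_leNgt ?normr_real ?gtr0_real//.
  apply/negP => /zfP; rewrite PE hornerZ mulf_eq0 (negbTE lP0)/=.
  by rewrite -/(root _ _) root_prod_XsubC wws.
have [Q0] := log_deriv_disc zr wsr erefl.
set Q := \prod_(_ <- _) _ in Q0 PE *.
set Y := Q^`().[z] / Q.[z] => YQ.
(* The degree may be below n + 1: each missing root counts as a root at infinity and contributes
   conj(z), of modulus less than r. *)
have {}YQ : `|(r ^+ 2 - `|z| ^+ 2) * Y + z^* *+ n.+1| <= r *+ n.+1.
  rewrite -(subnKC sws) !mulrnDr addrA (le_trans (ler_normD _ _))// lerD//.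
  by rewrite normrMn norm_conjC lerMn2r ltW// orbT.
rewrite PE derivZ !hornerZ mulrCA -mulrnAr -mulrDr mulf_neq0//.
have -> : Q^`().[z] = Y * Q.[z] by rewrite mulfVK.
apply/eqP => /(congr1 (fun x => x / Q.[z])); rewrite mul0r -mulr_natr => E0.
have E : n.+1%:R = (z - zeta) * Y.
  by apply/eqP; rewrite -subr_eq0 -[X in _ == X]E0; apply/eqP; field.
(* By [E], 1 / (z - zeta) would be the mean of the terms of Y and hence lie in the disc, against
   [disc_strict]. *)
have : `|r ^+ 2 - z^* * zeta| *+ n.+1 <= r * `|z - zeta| *+ n.+1.
  have -> : `|r ^+ 2 - z^* * zeta| *+ n.+1 =
      `|(r ^+ 2 - `|z| ^+ 2) * Y + z^* *+ n.+1| * `|z - zeta|.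
    rewrite -normrM -normrMn -[_ *+ _ in LHS]mulr_natr -[z^* *+ _]mulr_natr E.
    by rewrite normCK; congr `|_|; ring.
  by rewrite -mulrnAl ler_wpM2r.
by rewrite lerMn2r/= lt_geF// disc_strict.
Qed.

(** * Binomial coefficients normalised away, and iterated polar derivatives *)

Definition binomial_poly n b := \poly_(j < n.+1) (b j *+ 'C(n, j)).

Lemma size_binomial_poly n b : (size (binomial_poly n b) <= n.+1)%N.
Proof. exact: size_poly. Qed.

Lemma coef_binomial_poly n b j : (binomial_poly n b)`_j = b j *+ 'C(n, j).
Proof. by rewrite coef_poly; case: ltnP => // nj; rewrite bin_small. Qed.

Lemma binomial_polyD n b1 b2 c :
  binomial_poly n (fun j => b1 j + c * b2 j) =
  binomial_poly n b1 + c *: binomial_poly n b2.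
Proof.
by apply/polyP=> j; rewrite coefD coefZ !coef_binomial_poly mulrnDl mulrnAr.
Qed.

Lemma binomial_poly_deriv n b :
  (binomial_poly n.+1 b)^`() = binomial_poly n (fun j => b j.+1) *+ n.+1.
Proof.
apply/polyP => j; rewrite coef_deriv coefMn !coef_binomial_poly -!mulrnA.
by congr (_ *+ _); rewrite mulnC -mul_bin_diag mulnC.
Qed.

Lemma binomial_poly_pascal n b : binomial_poly n.+1 b =
  binomial_poly n b + 'X * binomial_poly n (fun j => b j.+1).
Proof.
apply/polyP => -[|j]; rewrite coefD coefXM !coef_binomial_poly /=.
  by rewrite !bin0 addr0.
by rewrite binS mulrnDr.
Qed.

(** With binomial weights, the term in X from Pascal's rule cancels z P' in (n + 1) P + (zeta - z)
    P'. The polar derivative is therefore n + 1 times the polynomial of the sequence b_j + zeta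
    b_(j+1), and [laguerre] applies. *)
Lemma polar_step n b r zeta : zero_free r (binomial_poly n.+1 b) ->
  `|zeta| < r -> zero_free r (binomial_poly n (fun j => b j + zeta * b j.+1)).
Proof.
move=> zf zetar z zr.
have := laguerre (size_binomial_poly _ _) zf zr zetar.
rewrite binomial_poly_deriv {1}binomial_poly_pascal hornerMn mulrnAr -mulrnDl.
apply: contra => /eqP E; rewrite mulrn_eq0 /=; apply/eqP.
rewrite -[RHS]E (binomial_polyD n b (fun j => b j.+1)) !hornerE.
ring.
Qed.

Definition polar_seq b (zs : seq C) : nat -> C :=
  foldr (fun zeta b' j => b' j + zeta * b' j.+1) b zs.

(** Each polar step is 1 + zeta S, with S the shift of sequences. Iteration thus applies the product
    polynomial to S, and only this product matters, not the individual poles. *)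
Lemma polar_seqE b zs j : polar_seq b zs j =
  \sum_(k < (size zs).+1) (\prod_(zeta <- zs) (1 + zeta *: 'X))`_k * b (j + k)%N.
Proof.
elim: zs j => [|zeta zs IH] j.
  by rewrite big_ord1 big_nil coef1 mul1r addn0.
rewrite /= !IH big_cons; set Q := \prod_(_ <- zs) _.
(* The longer product has one more coefficient; this zero pads the sum for Q to the same range. *)
have Qs : Q`_(size zs).+1 = 0.
  apply: nth_default; rewrite /Q; elim: (zs) => [|x s IHs].
    by rewrite big_nil size_poly1.
  rewrite big_cons (leq_trans (size_polyMleq _ _))//.
  have : (size (1 + x *: 'X : {poly C})%R <= 2)%N.
    rewrite (leq_trans (size_polyD _ _))// geq_max size_poly1/=.
    by rewrite (leq_trans (size_scale_leq _ _))// size_polyX.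
  by move=> h; rewrite -subn1 leq_subLR (leq_trans (leq_add h IHs)).
rewrite mulr_sumr.
have cQ k : ((1 + zeta *: 'X) * Q)`_k = Q`_k + zeta * (if k is k'.+1 then Q`_k' else 0).
  by rewrite mulrDl mul1r -scalerAl coefD coefZ coefXM; case: k.
under [RHS]eq_bigr do rewrite cQ mulrDl.
rewrite big_split/=; congr (_ + _).
  by rewrite [RHS]big_ord_recr/= Qs mul0r addr0.
rewrite [RHS]big_ord_recl/= mulr0 mul0r add0r; apply: eq_bigr => k _.
by rewrite /bump/= add1n addnS addSn mulrA.
Qed.

Lemma polar_seq_zero_free n b r zs : (size zs <= n)%N ->
  zero_free r (binomial_poly n b) -> {in zs, forall zeta, `|zeta| < r} ->
  zero_free r (binomial_poly (n - size zs) (polar_seq b zs)).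
Proof.
elim: zs => [|zeta zs IH] sn zf zsr; first by rewrite subn0.
apply: polar_step; last by apply: zsr; rewrite inE eqxx.
rewrite -subSn//= subSS; apply: IH => //; first exact: ltnW.
by move=> x xs; apply: zsr; rewrite inE xs orbT.
Qed.

(** The poles are -1 / x for the roots x of X^s + 1 / w, so that |zeta|^s = |w| < r^s; for w = 0 all
    poles are 0. *)
Lemma binomial_factor s r w : (0 < s)%N -> 0 < r -> `|w| < r ^+ s ->
  exists zs : seq C, [/\ size zs = s, {in zs, forall zeta, `|zeta| < r} &
    \prod_(zeta <- zs) (1 + zeta *: 'X) = 1 + w *: 'X^s].
Proof.
move=> s0 r0 wr; have [->|w0] := eqVneq w 0.
  exists (nseq s 0); split; first by rewrite size_nseq.
    by move=> x /nseqP[-> _]; rewrite normr0.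
  by rewrite scale0r addr0 big1_seq// => x /=/nseqP[-> _]; rewrite scale0r addr0.
have [rs rsE] := closed_field_poly_normal ('X^s + (w^-1)%:P : {poly C}).
have lc : lead_coef ('X^s + (w^-1)%:P : {poly C}) = 1.
  by rewrite lead_coefXnaddC.
move: rsE; rewrite lc scale1r => rsE.
have srs : size rs = s.
  by apply: succn_inj; rewrite -(size_prod_XsubC rs id) -rsE size_XnaddC.
have rs_root x : x \in rs -> x ^+ s = - w^-1.
  rewrite -root_prod_XsubC -rsE rootE hornerD hornerXn hornerC addr_eq0.
  by move/eqP.
have rs0 x : x \in rs -> x != 0.
  move=> /rs_root xs; apply/eqP => x0; move: xs; rewrite x0 expr0n.
  by rewrite eqn0Ngt s0/= => /eqP; rewrite eq_sym oppr_eq0 invr_eq0 (negbTE w0).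
have wprod : w * \prod_(x <- rs) (- x) = 1.
  have := congr1 (fun p : {poly C} => p.[0]) rsE.
  rewrite hornerD hornerXn hornerC expr0n eqn0Ngt s0 add0r horner_prod => /esym.
  under eq_bigr do rewrite hornerXsubC sub0r.
  by move->; rewrite mulfV.
exists [seq - x^-1 | x <- rs]; split; first by rewrite size_map.
  move=> _ /mapP[x xrs ->]; rewrite normrN normfV.
  rewrite -(@ltr_pXn2r _ s)// ?nnegrE ?invr_ge0 ?(ltW r0)//.
  by rewrite exprVn -normrX (rs_root x xrs) normrN normfV invrK.
rewrite big_map.
have -> : 1 + w *: 'X^s = w *: ('X^s + (w^-1)%:P).
  by rewrite scalerDr -(mul_polyC w (w^-1)%:P) -polyCM mulfV// addrC.
rewrite rsE -[LHS]scale1r -wprod -scalerA; congr (_ *: _).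
rewrite -[LHS]mul_polyC rmorph_prod/= -big_split/=.
apply: eq_big_seq => x xrs; rewrite mulrDr mulr1 -scalerAr -mul_polyC mulrA.
by rewrite -polyCM mulrNN mulVf ?rs0// mul1r polyCN addrC.
Qed.

(* The polynomials U and V of the introductory comment. *)
Definition low_part n s P := binomial_poly (n - s) (fun j => P`_j / 'C(n, j)%:R).
Definition high_part n s P :=
  binomial_poly (n - s) (fun j => P`_(j + s) / 'C(n, j + s)%:R).

(* The instance of Grace's theorem for the apolar factor
   (1 + X)^(n - s) * (1 + w X^s). *)
Lemma grace n s P r z w : (0 < s <= n)%N -> (size P <= n.+1)%N ->
  zero_free r P -> `|z| < r -> `|w| < r ^+ s ->
  (low_part n s P).[z] + w * (high_part n s P).[z] != 0.
Proof.
move=> /andP[s0 sn] sP zf zr wr; have r0 : 0 < r by rewrite (le_lt_trans _ zr).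
have [zs [szs zsr zsE]] := binomial_factor s0 r0 wr.
pose b j := P`_j / 'C(n, j)%:R.
have PE : P = binomial_poly n b.
  apply/polyP => j; rewrite coef_binomial_poly /b -[RHS]mulr_natr.
  have [jn|nj] := leqP j n; first by rewrite mulfVK// pnatr_eq0 -lt0n bin_gt0.
  by rewrite bin_small// mulr0 nth_default// (leq_trans sP).
move: zf; rewrite {1}PE => zf.
have := @polar_seq_zero_free n b r zs; rewrite szs => /(_ sn zf zsr z zr).
(* The product of the factors is 1 + w X^s, so only the shifts by 0 and by s survive. *)
suff -> : polar_seq b zs = fun j => b j + w * b (j + s)%N.
  by rewrite (binomial_polyD _ b (fun j => b (j + s)%N)) hornerD hornerZ.
apply/funext => j; rewrite polar_seqE zsE szs.
under eq_bigr do rewrite coefD coef1 coefZ coefXn mulrDl.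
rewrite big_split/=; congr (_ + _).
  rewrite (bigD1 ord0)//= mul1r addn0 big1 ?addr0// => k.
  by rewrite -val_eqE/= => /negbTE ->; rewrite mul0r.
rewrite (bigD1 ord_max)//= eqxx mulr1 big1 ?addr0// => k.
by rewrite -val_eqE/= => /negbTE ->; rewrite mulr0 mul0r.
Qed.

Lemma low_partD n s P1 P2 c :
  low_part n s (P1 + c *: P2) = low_part n s P1 + c *: low_part n s P2.
Proof.
rewrite -binomial_polyD; congr binomial_poly; apply/funext => j.
by rewrite coefD coefZ mulrDl mulrA.
Qed.

Lemma high_partD n s P1 P2 c :
  high_part n s (P1 + c *: P2) = high_part n s P1 + c *: high_part n s P2.
Proof.
rewrite -binomial_polyD; congr binomial_poly; apply/funext => j.
by rewrite coefD coefZ mulrDl mulrA.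
Qed.

(** Otherwise w = - U / V has modulus less than r^s and gives a zero excluded by [grace]. *)
Lemma grace_le n s r P z : (0 < s <= n)%N -> (size P <= n.+1)%N ->
  zero_free r P -> `|z| < r ->
  r ^+ s * `|(high_part n s P).[z]| <= `|(low_part n s P).[z]|.
Proof.
move=> sn sP zf zr; have r0 : 0 < r by rewrite (le_lt_trans _ zr).
have G := grace sn sP zf zr.
set U := _.[z] in G *; set V := _.[z] in G *.
rewrite real_leNgt ?realM ?normr_real ?ger0_real ?exprn_ge0 ?ltW//.
apply/negP => UV; have V0 : V != 0.
  by apply/eqP => V0; move: UV; rewrite V0 normr0 mulr0 normr_lt0.
have := G (- (U / V)); rewrite mulNr mulfVK// subrr eqxx normrN normf_div.
by rewrite ltr_pdivrMr ?normr_gt0// => /(_ UV).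
Qed.

Definition arestov n s w P := low_part n s P + w *: ('X^s * high_part n s P).

Lemma arestovD n s w P1 P2 c :
  arestov n s w (P1 + c *: P2) = arestov n s w P1 + c *: arestov n s w P2.
Proof.
rewrite /arestov low_partD high_partD mulrDr -scalerAr !scalerDr !scalerA.
by rewrite (mulrC w) addrACA.
Qed.

Lemma coef0_low_part n s P : (low_part n s P)`_0 = P`_0.
Proof. by rewrite coef_binomial_poly !bin0 divr1. Qed.

Lemma coef0_arestov n s w P : (0 < s)%N -> (arestov n s w P)`_0 = P`_0.
Proof.
by move=> s0; rewrite coefD coefZ coefXnM s0 mulr0 addr0 coef0_low_part.
Qed.

Lemma arestov_const n s w c : (0 < s)%N -> arestov n s w c%:P = c%:P.
Proof.
move=> s0; rewrite /arestov; have -> : high_part n s c%:P = 0.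
  apply/polyP => j; rewrite coef_binomial_poly coefC coef0 addn_eq0.
  by rewrite (gtn_eqF s0) andbF mul0r mul0rn.
rewrite mulr0 scaler0 addr0; apply/polyP => j.
rewrite coef_binomial_poly !coefC; case: eqP => [->|_].
  by rewrite !bin0 divr1.
by rewrite mul0r mul0rn.
Qed.

(** [grace] is a pointwise statement, so its parameter may depend on z. Here it is w z^s, of modulus
    less than 1 even when |w| = 1, since s > 0. *)
Lemma arestov_zero_free n s w P : (0 < s <= n)%N -> (size P <= n.+1)%N ->
  `|w| <= 1 -> zero_free 1 P -> zero_free 1 (arestov n s w P).
Proof.
move=> sn sP w1 zf z z1; rewrite /arestov hornerD hornerZ hornerM hornerXn mulrA.
apply: (grace sn sP zf z1); rewrite expr1n normrM normrX.
rewrite (le_lt_trans (ler_piMl _ w1)) ?exprn_ge0// exprn_ilt1//.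
by rewrite gtn_eqF//; case/andP: sn.
Qed.

(** * Reflection of roots in the unit circle *)

Definition reflect_root w : {poly C} :=
  if `|w| < 1 then 1 - w^* *: 'X else 'X - w%:P.

(** For |w| < 1 the squared moduli differ by (1 - |w|^2) (1 - |z|^2), which is [disc_identity] with
    r = 1; they agree on the circle. *)
Lemma reflect_root_le w z : `|z| <= 1 ->
  `|('X - w%:P).[z]| <= `|(reflect_root w).[z]|.
Proof.
move=> z1; rewrite /reflect_root; case: ifPn => // w1.
rewrite hornerXsubC !hornerE -ler_sqr ?nnegrE// -subr_ge0.
have := @disc_identity 1 w z (real1 _).
rewrite !expr1n !mul1r [`|w - z|]distrC => ->.
by rewrite mulr_ge0// subr_ge0 expr_le1// ltW.
Qed.

Lemma reflect_root_zero_free w : zero_free 1 (reflect_root w).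
Proof.
move=> z z1; rewrite /reflect_root; case: ifPn => w1; rewrite !hornerE.
  apply/eqP => /eqP; rewrite subr_eq0 => /eqP/(congr1 Num.norm).
  rewrite normr1 normrM norm_conjC => E.
  by have := mulr_ilt1 (normr_ge0 _) (normr_ge0 _) w1 z1; rewrite -E ltxx.
by rewrite subr_eq0; apply: contraNneq w1 => <-.
Qed.

Lemma size_reflect_root w : (size (reflect_root w) <= 2)%N.
Proof.
rewrite /reflect_root; case: ifP => _; last by rewrite size_XsubC.
rewrite (leq_trans (size_polyD _ _))// geq_max size_poly1/= size_polyN.
by rewrite (leq_trans (size_scale_leq _ _))// size_polyX.
Qed.

Definition reflect_roots c (ws : seq C) := c *: \prod_(w <- ws) reflect_root w.

Lemma size_reflect_roots c ws : (size (reflect_roots c ws) <= (size ws).+1)%N.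
Proof.
rewrite (leq_trans (size_scale_leq _ _))//; elim: ws => [|w ws IH].
  by rewrite big_nil size_poly1.
rewrite big_cons (leq_trans (size_polyMleq _ _))// -subn1 leq_subLR.
by rewrite (leq_trans (leq_add (size_reflect_root _) IH)).
Qed.

Lemma reflect_roots_zero_free c ws : c != 0 -> zero_free 1 (reflect_roots c ws).
Proof.
move=> c0 z z1; rewrite hornerZ mulf_neq0// horner_prod prodf_seq_neq0.
by apply/allP => w _; exact: reflect_root_zero_free.
Qed.

Lemma reflect_roots_le c ws z : `|z| <= 1 ->
  `|(c *: \prod_(w <- ws) ('X - w%:P)).[z]| <= `|(reflect_roots c ws).[z]|.
Proof.
move=> z1; rewrite !hornerZ !normrM ler_wpM2l// !horner_prod !normr_prod.
by apply: ler_prod => w _; rewrite normr_ge0 reflect_root_le.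
Qed.

(** By Jensen's formula the right-hand side is the Mahler measure of the polynomial before
    reflection. *)
Lemma norm_reflect_roots0 c ws : `|(reflect_roots c ws)`_0| =
  `|c| * \prod_(w <- ws) (if `|w| < 1 then 1 else `|w|).
Proof.
rewrite -horner_coef0 hornerZ normrM horner_prod normr_prod; congr (_ * _).
apply: eq_bigr => w _; rewrite /reflect_root; case: ifP => _.
  by rewrite hornerD hornerN hornerZ hornerX hornerC mulr0 subr0 normr1.
by rewrite hornerXsubC sub0r normrN.
Qed.

(* [reflect_roots c ws] has the modulus of R on the unit circle and dominates R
   in the disc, so the sums R* + e R stay zero free for |e| < 1 and so do their
   images under [arestov]. *)
Lemma arestov_reflect_le n s w c (ws : seq C) z : (0 < s <= n)%N ->
  (size ws <= n)%N -> `|w| <= 1 -> c != 0 -> `|z| < 1 ->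
  `|(arestov n s w (c *: \prod_(w <- ws) ('X - w%:P))).[z]| <=
  `|(arestov n s w (reflect_roots c ws)).[z]|.
Proof.
move=> sn wsn w1 c0 z1; set P := c *: _; set Q := reflect_roots _ _.
have sQ : (size Q <= n.+1)%N by rewrite (leq_trans (size_reflect_roots _ _)).
have sP : (size P <= n.+1)%N.
  by rewrite (leq_trans (size_scale_leq _ _))// size_prod_XsubC.
have zfQ : zero_free 1 Q by exact: reflect_roots_zero_free.
have zfQP e : `|e| < 1 -> zero_free 1 (Q + e *: P).
  move=> e1 y y1; rewrite hornerD (hornerZ e P); apply/eqP => /eqP; rewrite addr_eq0.
  move=> /eqP/(congr1 Num.norm); rewrite normrN normrM => E.
  have := reflect_roots_le c ws (ltW y1); rewrite real_leNgt ?normr_real//.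
  have Q0 : 0 < `|Q.[y]| by rewrite normr_gt0 zfQ.
  have P0 : 0 < `|P.[y]|.
    by rewrite normr_gt0; apply: contraTneq Q0 => P0; rewrite E P0 normr0 mulr0 ltxx.
  by rewrite E gtr_pMl// e1.
rewrite real_leNgt ?normr_real//; apply/negP => QP.
have P0 : (arestov n s w P).[z] != 0.
  by rewrite -normr_gt0 (le_lt_trans _ QP).
pose e := - ((arestov n s w Q).[z] / (arestov n s w P).[z]).
have e1 : `|e| < 1 by rewrite normrN normf_div ltr_pdivrMr ?mul1r// normr_gt0.
have sQP : (size (Q + e *: P)%R <= n.+1)%N.
  rewrite (leq_trans (size_polyD _ _))// geq_max sQ/=.
  by rewrite (leq_trans (size_scale_leq _ _)).
have := arestov_zero_free sn sQP w1 (zfQP _ e1) z1.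
by rewrite arestovD hornerD (hornerZ e) mulNr mulfVK// subrr eqxx.
Qed.


End Grace.

(** * Integrals of periodic functions *)

Section PeriodicIntegral.
Context {R : realType}.
Local Notation mu := (@lebesgue_measure R).
Local Open Scope ereal_scope.

(** Lebesgue measure equals k times its pushforward under t -> k t + c, by uniqueness, since both
    agree on half-open intervals. For nonnegative functions no integrability is involved. *)
Lemma ge0_integral_affine (f : R -> \bar R) (k c a b : R) : (0 < k)%R ->
  measurable_fun [set: R] f -> (forall t, 0 <= f t) ->
  \int[mu]_(t in `](k * a + c)%R, (k * b + c)%R]) f t =
  k%:E * \int[mu]_(t in `]a, b]) f (k * t + c)%R.
Proof.
move=> k0 mf f0.
pose phi : measurableTypeR R -> measurableTypeR R := fun t => (k * t + c)%R.
have mphi : measurable_fun setT phi.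
  by apply: measurable_funD => //; exact: measurable_funM.
have preim x y : phi @^-1` `](k * x + c)%R, (k * y + c)%R]%classic =
    `]x, y]%classic.
  apply/seteqP; split=> t /=; rewrite /phi !in_itv/= ltrD2r lerD2r.
    by rewrite ltr_pM2l// ler_pM2l.
  by rewrite ltr_pM2l// ler_pM2l.
pose kn : {nonneg R} := NngNum (ltW k0).
have muE A : measurable A ->
    mu A = mscale kn (pushforward mu phi : {measure set (measurableTypeR R) -> \bar R}) A.
  apply: lebesgue_measure_unique => _ [[x y] _ <-] /=.
  rewrite /mscale/= /pushforward.
  have kx u : u = (k * ((u - c) / k) + c)%R by field; rewrite gt_eqF.
  rewrite {2}(kx x) {2}(kx y) preim !lebesgue_measure_itv/= !lte_fin.
  rewrite ltr_pM2r ?invr_gt0// ltrD2r; case: ifPn => _; last by rewrite mule0.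
  by rewrite -!EFinB -EFinM; congr EFin; field; rewrite gt_eqF.
rewrite (eq_measure_integral _ (fun A mA _ => muE mphi A mA)).
have mfD : measurable_fun `](k * a + c)%R, (k * b + c)%R]%classic f.
  exact: measurable_funTS.
rewrite ge0_integral_mscale//= ge0_integral_pushforward//=.
  by rewrite preim.
Qed.

Lemma ge0_integral_itv_split (f : R -> \bar R) (a b c : R) :
  measurable_fun [set: R] f -> (forall t, 0 <= f t) -> (a <= b <= c)%R ->
  \int[mu]_(t in `]a, c]) f t =
  \int[mu]_(t in `]a, b]) f t + \int[mu]_(t in `]b, c]) f t.
Proof.
move=> mf f0 /andP[ab bc]; rewrite -ge0_integral_setU//=.
- by rewrite -itv_bndbnd_setU// bnd_simp.
- exact: measurable_funTS.
- apply: lt_disjoint => x y; rewrite !in_itv/= => /andP[_ xb] /andP[by_ _].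
  exact: le_lt_trans by_.
Qed.

(** The part of the shifted interval beyond T is the translate by T of the missing part []0, c]]. *)
Lemma ge0_integral_period_shift (f : R -> \bar R) (T c : R) : (0 <= c <= T)%R ->
  measurable_fun [set: R] f -> (forall t, 0 <= f t) -> (forall t, f (t + T)%R = f t) ->
  \int[mu]_(t in `]c, (c + T)%R]) f t = \int[mu]_(t in `]0%R, T]) f t.
Proof.
move=> /andP[c0 cT] mf f0 fT.
rewrite (@ge0_integral_itv_split _ _ T)// ?cT ?lerDr//.
rewrite [RHS](@ge0_integral_itv_split _ _ c)// ?c0// addeC; congr (_ + _).
have := @ge0_integral_affine f 1 T 0 c ltr01 mf f0.
rewrite mulr0 add0r mul1r mul1e => ->.
by apply: eq_integral => t _; rewrite mul1r fT.
Qed.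

Lemma ge0_integral_period_muln (f : R -> \bar R) (T : R) n : (0 <= T)%R ->
  measurable_fun [set: R] f -> (forall t, 0 <= f t) -> (forall t, f (t + T)%R = f t) ->
  \int[mu]_(t in `]0%R, (n%:R * T)%R]) f t =
  n%:R%:E * \int[mu]_(t in `]0%R, T]) f t.
Proof.
move=> T0 mf f0 fT; elim: n => [|n IH].
  by rewrite mul0r mul0e set_itvoc0 integral_set0.
rewrite (@ge0_integral_itv_split _ _ (n%:R * T)%R)//; last first.
  by rewrite mulr_ge0//= ler_wpM2r// ler_nat.
rewrite IH.
have -> : \int[mu]_(t in `](n%:R * T)%R, (n.+1%:R * T)%R]) f t =
    \int[mu]_(t in `]0%R, T]) f t.
  have := @ge0_integral_affine f 1 (n%:R * T) 0 T ltr01 mf f0.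
  rewrite mulr0 add0r mul1r mul1e.
  have -> : (T + n%:R * T = n.+1%:R * T)%R by rewrite -natr1; ring.
  move=> ->; apply: eq_integral => t _; rewrite mul1r.
  elim: (n) => [|m IHm]; first by rewrite mul0r addr0.
  by rewrite -natr1 mulrDl mul1r addrA fT.
rewrite -[X in _ + X]mul1e -ge0_muleDl//.
by rewrite -EFinD natr1.
Qed.

Lemma ge0_circle_mean_shift (f : R -> \bar R) (c : R) : (0 <= c <= 2 * pi)%R ->
  measurable_fun [set: R] f -> (forall t, 0 <= f t) ->
  (forall t, f (t + 2 * pi)%R = f t) ->
  circle_mean (fun t => f (t + c)%R) = circle_mean f.
Proof.
move=> c2 mf f0 fT; rewrite /circle_mean; congr (_ * _).
have mfc : measurable_fun [set: R] (fun t => f (t + c)%R).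
  by apply: measurableT_comp => //; exact: measurable_funD.
rewrite -!integral_itv_obnd_cbnd; try exact: measurable_funTS.
rewrite -(ge0_integral_period_shift c2 mf f0 fT).
have := @ge0_integral_affine f 1 c 0 (2 * pi) ltr01 mf f0.
rewrite mulr0 add0r mul1r mul1e addrC => ->.
by apply: eq_integral => t _; rewrite mul1r.
Qed.

Lemma ge0_circle_mean_muln (f : R -> \bar R) n : (0 < n)%N ->
  measurable_fun [set: R] f -> (forall t, 0 <= f t) ->
  (forall t, f (t + 2 * pi)%R = f t) ->
  circle_mean (fun t => f (n%:R * t)%R) = circle_mean f.
Proof.
move=> n0 mf f0 fT; rewrite /circle_mean; congr (_ * _).
have mfc : measurable_fun [set: R] (fun t => f (n%:R * t)%R).
  by apply: measurableT_comp => //; exact: measurable_funM.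
rewrite -!integral_itv_obnd_cbnd; try exact: measurable_funTS.
have n0' : (0 < n%:R :> R)%R by rewrite ltr0n.
have := @ge0_integral_affine f n%:R 0 0 (2 * pi) n0' mf f0.
rewrite mulr0 !addr0 ge0_integral_period_muln//; last first.
  by rewrite mulr_ge0// pi_ge0.
under [X in _ = _ * X]eq_integral do rewrite addr0.
move=> /(congr1 (fun x => (n%:R^-1)%:E * x)); rewrite !muleA -EFinM.
by rewrite mulVf ?gt_eqF// !mul1e.
Qed.

(** Extends invariance from nonnegative to signed functions without integrability, so that
    logarithms with value -oo are covered. *)
Lemma circle_mean_pos_neg (f g : R -> \bar R) :
  circle_mean f^\+ = circle_mean g^\+ -> circle_mean f^\- = circle_mean g^\- ->
  circle_mean f = circle_mean g.
Proof.
have p0 : ((2 * pi)^-1 != 0 :> R)%R by rewrite invr_neq0// mulf_neq0// gt_eqF// pi_gt0.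
have cancel x y : ((2 * pi)^-1)%:E * x = ((2 * pi)^-1)%:E * y -> x = y :> \bar R.
  move=> /(congr1 (fun x => (((2 * pi)^-1)^-1)%:E * x)).
  by rewrite !muleA -EFinM mulVf// !mul1e.
rewrite /circle_mean => /cancel fg1 /cancel fg2.
by rewrite integralE [in RHS]integralE fg1 fg2.
Qed.

Lemma circle_mean_shift (f : R -> \bar R) (c : R) : (0 <= c <= 2 * pi)%R ->
  measurable_fun [set: R] f -> (forall t, f (t + 2 * pi)%R = f t) ->
  circle_mean (fun t => f (t + c)%R) = circle_mean f.
Proof.
move=> c2 mf fT; apply: circle_mean_pos_neg.
- rewrite -(@ge0_circle_mean_shift f^\+ c)//.
  + by congr circle_mean; apply/funext => t; rewrite !funeposE.
  + exact: measurable_funepos.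
  + by move=> t; rewrite !funeposE fT.
- rewrite -(@ge0_circle_mean_shift f^\- c)//.
  + by congr circle_mean; apply/funext => t; rewrite !funenegE.
  + exact: measurable_funeneg.
  + by move=> t; rewrite !funenegE fT.
Qed.

Lemma circle_mean_muln (f : R -> \bar R) n : (0 < n)%N ->
  measurable_fun [set: R] f -> (forall t, f (t + 2 * pi)%R = f t) ->
  circle_mean (fun t => f (n%:R * t)%R) = circle_mean f.
Proof.
move=> c2 mf fT; apply: circle_mean_pos_neg.
- rewrite -(@ge0_circle_mean_muln f^\+ n)//.
  + by congr circle_mean; apply/funext => t; rewrite !funeposE.
  + exact: measurable_funepos.
  + by move=> t; rewrite !funeposE fT.
- rewrite -(@ge0_circle_mean_muln f^\- n)//.
  + by congr circle_mean; apply/funext => t; rewrite !funenegE.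
  + exact: measurable_funeneg.
  + by move=> t; rewrite !funenegE fT.
Qed.

End PeriodicIntegral.

(** * Modulus and the unit circle *)

Section Modulus.
Context {R : realType}.
Implicit Types x y z : R[i].

Lemma modulusE z : `|z| = real_complex R (modulus z).
Proof. by case: z. Qed.

Lemma le_modulus x y : (modulus x <= modulus y) = (`|x| <= `|y|).
Proof. by rewrite !modulusE lecR. Qed.

Lemma modulusM x y : modulus (x * y) = modulus x * modulus y.
Proof. exact: ComplexField.Normc.normcM. Qed.

Lemma modulusV x : modulus x^-1 = (modulus x)^-1.
Proof. exact: ComplexField.Normc.normcV. Qed.

Lemma modulus0 : modulus 0 = 0 :> R.
Proof. exact: ComplexField.Normc.normc0. Qed.

Lemma modulus1 : modulus 1 = 1 :> R.
Proof. exact: ComplexField.Normc.normc1. Qed.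

Lemma modulusN x : modulus (- x) = modulus x.
Proof. exact: normcN. Qed.

Lemma modulusX x n : modulus (x ^+ n) = modulus x ^+ n.
Proof. by elim: n => [|n IH]; rewrite ?expr0 ?modulus1// !exprS modulusM IH. Qed.

Lemma modulusD x y : modulus (x + y) <= modulus x + modulus y.
Proof. exact: le_normcD. Qed.

Lemma modulusB x y : modulus x - modulus y <= modulus (x - y).
Proof. by rewrite lerBlDr (le_trans _ (modulusD _ _))// subrK. Qed.

Lemma modulus_dist x y : `|modulus x - modulus y| <= modulus (x - y).
Proof. by rewrite ler_norml modulusB andbT lerNl opprB -[leRHS]modulusN opprB modulusB. Qed.

Lemma modulus_ge0 x : 0 <= modulus x.
Proof. by case: x => a b; exact: sqrtr_ge0. Qed.

Lemma modulus_eq0 x : (modulus x == 0) = (x == 0).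
Proof.
apply/eqP/eqP => [/ComplexField.Normc.eq0_normc//|->]; exact: modulus0.
Qed.

Lemma modulus_gt0 x : (0 < modulus x) = (x != 0).
Proof. by rewrite lt_neqAle modulus_ge0 andbT eq_sym modulus_eq0. Qed.

Lemma modulus_real (r : R) : modulus (real_complex R r) = `|r|.
Proof. by rewrite /modulus/= expr0n/= addr0 sqrtr_sqr. Qed.

Lemma modulus_conj x : modulus x^* = modulus x.
Proof. by apply: (@complexI R); rewrite -!modulusE norm_conjC. Qed.

Lemma modulusM_conj x : real_complex R (modulus x ^+ 2) = x * x^*.
Proof. by rewrite rmorphXn/= -modulusE normCK. Qed.

Lemma expiD (s t : R) : expi (s + t) = expi s * expi t.
Proof. by rewrite /expi cosD sinD; simpc; congr Complex; rewrite addrC. Qed.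

Lemma expi0 : expi 0 = 1 :> R[i].
Proof. by rewrite /expi cos0 sin0. Qed.

Lemma modulus_expi (t : R) : modulus (expi t) = 1.
Proof. by rewrite /modulus/= cos2Dsin2 sqrtr1. Qed.

Lemma expi_2pi : expi (2 * pi) = 1 :> R[i].
Proof. by rewrite /expi mulr_natl cos2pi sin2pi. Qed.

Lemma expi_period (t : R) : expi (t + 2 * pi) = expi t.
Proof. by rewrite expiD expi_2pi mulr1. Qed.

Lemma expi_muln n (t : R) : expi (n%:R * t) = expi t ^+ n.
Proof.
elim: n => [|n IH]; first by rewrite mul0r expi0.
by rewrite -natr1 mulrDl mul1r expiD IH exprSr.
Qed.

Lemma expi_surj z : modulus z = 1 -> exists2 t : R, 0 <= t <= 2 * pi & expi t = z.
Proof.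
case: z => a b /(congr1 (fun x : R => x ^+ 2)).
rewrite /modulus/= sqr_sqrtr ?addr_ge0 ?sqr_ge0// expr1n => ab.
have a1 : -1 <= a <= 1.
  by rewrite -ler_norml -(@ler_sqr R)// ?nnegrE// expr1n real_normK ?num_real// -ab lerDl sqr_ge0.
have ca : cos (acos a) = a by rewrite acosK// in_itv.
have sa : sin (acos a) = `|b|.
  have s0 : 0 <= sin (acos a) by rewrite sin_ge0_pi// acos_ge0// acos_lepi.
  apply/eqP; rewrite -(@eqrXn2 _ 2)// real_normK ?num_real//.
  by rewrite sin2cos2 ca -ab [_ + b ^+ 2]addrC addrK.
have [b0|b0] := leP 0 b.
  exists (acos a); last by rewrite /expi ca sa ger0_norm.
  by rewrite acos_ge0//= (le_trans (acos_lepi a1))// ler_peMl ?pi_ge0// ler1n.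
exists (2 * pi - acos a).
  rewrite subr_ge0 (le_trans (acos_lepi a1)) ?ler_peMl ?pi_ge0// ?ler1n//=.
  by rewrite lerBlDl lerDr acos_ge0.
rewrite addrC expiD expi_2pi mulr1 /expi cosN sinN ca sa ltr0_norm// opprK.
by [].
Qed.

End Modulus.

(** * Measurability and circle means *)

Section ComplexMeasurable.
Context {R : realType} d (T : measurableType d).
Implicit Types f g : T -> R[i].

Definition cmeasurable f :=
  measurable_fun [set: T] (fun x => complex.Re (f x)) /\
  measurable_fun [set: T] (fun x => complex.Im (f x)).

Lemma cmeasurable_cst c : cmeasurable (fun=> c).
Proof. by split; exact: measurable_cst. Qed.

Lemma cmeasurableD f g : cmeasurable f -> cmeasurable g ->
  cmeasurable (fun x => f x + g x).
Proof.
move=> [f1 f2] [g1 g2]; split.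
- rewrite (_ : (fun _ => _) = (fun x => complex.Re (f x) + complex.Re (g x))).
    exact: measurable_funD.
  by apply/funext => x; case: (f x) => ? ?; case: (g x).
- rewrite (_ : (fun _ => _) = (fun x => complex.Im (f x) + complex.Im (g x))).
    exact: measurable_funD.
  by apply/funext => x; case: (f x) => ? ?; case: (g x).
Qed.

Lemma cmeasurableM f g : cmeasurable f -> cmeasurable g ->
  cmeasurable (fun x => f x * g x).
Proof.
move=> [f1 f2] [g1 g2]; split.
- rewrite (_ : (fun _ => _) = (fun x => complex.Re (f x) * complex.Re (g x)
     - complex.Im (f x) * complex.Im (g x))).
    by apply: measurable_funB; exact: measurable_funM.
  by apply/funext => x; case: (f x) => ? ?; case: (g x).
- rewrite (_ : (fun _ => _) = (fun x => complex.Re (f x) * complex.Im (g x)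
     + complex.Im (f x) * complex.Re (g x))).
    by apply: measurable_funD; exact: measurable_funM.
  by apply/funext => x; case: (f x) => ? ?; case: (g x).
Qed.

Lemma cmeasurable_horner (Q : {poly R[i]}) f : cmeasurable f ->
  cmeasurable (fun x => Q.[f x]).
Proof.
move=> mf; elim/poly_ind: Q => [|Q c IH].
  rewrite (_ : (fun _ => _) = fun=> 0); first exact: cmeasurable_cst.
  by apply/funext => x; rewrite horner0.
rewrite (_ : (fun _ => _) = fun x => Q.[f x] * f x + c); last first.
  by apply/funext => x; rewrite hornerD hornerMX hornerC.
by apply: cmeasurableD; [exact: cmeasurableM|exact: cmeasurable_cst].
Qed.

Lemma cmeasurable_expi (g : T -> R) : measurable_fun [set: T] g ->
  cmeasurable (fun x => expi (g x)).
Proof.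
move=> mg; split; apply: measurableT_comp => //.
- by apply: continuous_measurable_fun; exact: continuous_cos.
- by apply: continuous_measurable_fun; exact: continuous_sin.
Qed.

Lemma measurable_modulus f : cmeasurable f ->
  measurable_fun [set: T] (fun x => modulus (f x)).
Proof.
move=> [f1 f2].
rewrite (_ : (fun _ => _) = (fun x => Num.sqrt (complex.Re (f x) ^+ 2 +
   complex.Im (f x) ^+ 2))).
  apply: (@measurableT_comp _ _ _ _ _ _ (@Num.sqrt R)).
    by apply: continuous_measurable_fun; exact: sqrt_continuous.
  by apply: measurable_funD; exact: measurable_funX.
by apply/funext => x; case: (f x).
Qed.

Lemma measurable_lne_EFin (g : T -> R) : measurable_fun [set: T] g ->
  measurable_fun [set: T] (fun x => lne (g x)%:E).
Proof.
move=> mg; apply: (@measurableT_comp _ _ _ _ _ _ (fun r : R => lne r%:E)) => //.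
rewrite /lne; apply: measurable_fun_ifT => //.
- exact: measurable_fun_ler.
- by apply/measurable_EFinP; exact: measurable_ln.
Qed.

Definition mlog (z : R[i]) : \bar R := lne (modulus z)%:E.

Lemma measurable_mlog f : cmeasurable f ->
  measurable_fun [set: T] (fun x => mlog (f x)).
Proof. by move=> mf; apply: measurable_lne_EFin; exact: measurable_modulus. Qed.

End ComplexMeasurable.

(** * Finite means over the circle and their invariance *)

Section HasMean.
Context {R : realType}.
Local Notation mu := (@lebesgue_measure R).
Local Notation I := `[0%R, (2 * pi)%R]%classic.
Local Open Scope ereal_scope.
Implicit Types (f g : R -> \bar R) (F : R[i] -> \bar R).

(** Carrying integrability along with the value lets means be added, negated and compared without
    side conditions. *)
Definition has_mean f (m : R) := mu.-integrable I f /\ circle_mean f = m%:E.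

Let p0 : (0 < 2 * pi :> R)%R. Proof. by rewrite mulr_gt0// pi_gt0. Qed.

Lemma circle_mean_cst (c : R) : circle_mean (fun=> c%:E) = c%:E.
Proof.
rewrite /circle_mean integral_cst//= lebesgue_measure_itv/= lte_fin p0.
by rewrite sube0 muleCA -EFinM mulVf ?mulr1 ?gt_eqF// mule1.
Qed.

Lemma has_mean_cst (c : R) : has_mean (fun=> c%:E) c.
Proof.
split; last exact: circle_mean_cst.
apply/integrableP; split; first exact: measurable_cst.
rewrite integral_cst//= lebesgue_measure_itv/= lte_fin p0.
by rewrite sube0 -EFinM ltry.
Qed.

Lemma has_meanD f g a b : has_mean f a -> has_mean g b ->
  has_mean (fun t => f t + g t) (a + b).
Proof.
move=> [fi fa] [gi gb]; split; first exact: integrableD.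
rewrite /circle_mean integralD// muleDr//; first by rewrite EFinD -fa -gb.
by rewrite fin_num_adde_defr// integrable_fin_num.
Qed.

Lemma has_meanN f a : has_mean f a -> has_mean (fun t => - f t) (- a).
Proof.
move=> [fi fa]; split; first exact: integrableN.
rewrite /circle_mean integralN; last first.
  by rewrite fin_num_adde_defl// fin_numN integrable_neg_fin_num.
by rewrite muleN EFinN -fa.
Qed.

Lemma le_circle_mean f g : mu.-integrable I f -> mu.-integrable I g ->
  (forall t, f t <= g t) -> circle_mean f <= circle_mean g.
Proof.
move=> fi gi fg; rewrite /circle_mean lee_pmul2l//; last first.
  by rewrite lte_fin invr_gt0.
by apply: le_integral => //; move=> t _; exact: fg.
Qed.

Lemma ge0_le_circle_mean f g : measurable_fun [set: R] f ->
  measurable_fun [set: R] g -> (forall t, 0 <= f t) ->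
  (forall t, f t <= g t) -> circle_mean f <= circle_mean g.
Proof.
move=> mf mg f0 fg; rewrite /circle_mean lee_pmul2l//; last first.
  by rewrite lte_fin invr_gt0.
apply: ge0_le_integral => //; [exact: measurable_funTS|exact: measurable_funTS].
Qed.

Lemma has_mean_le f g a b : has_mean f a -> has_mean g b ->
  (forall t, f t <= g t) -> (a <= b)%R.
Proof.
by move=> [fi fa] [gi gb] fg; rewrite -lee_fin -fa -gb le_circle_mean.
Qed.

Lemma integrable_has_mean f : mu.-integrable I f ->
  has_mean f (fine (circle_mean f)).
Proof.
move=> fi; split => //; rewrite fineK// /circle_mean fin_numM//.
exact: integrable_fin_num.
Qed.

Lemma bounded_has_mean f (B : R) : measurable_fun [set: R] f ->
  (forall t, `|f t| <= B%:E) -> exists2 m, has_mean f m & (`|m| <= B)%R.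
Proof.
move=> mf fB; have fi : mu.-integrable I f.
  have [Bi _] := has_mean_cst B.
  apply: le_integrable Bi => //; first exact: measurable_funTS.
  by move=> t _; rewrite (le_trans (fB t))//= lee_fin ler_norm.
exists (fine (circle_mean f)); first exact: integrable_has_mean.
have hm := integrable_has_mean fi; rewrite ler_norml; apply/andP; split.
  apply: has_mean_le (has_mean_cst _) hm _ => t.
  by move: (fB t); case: (f t) => [r| |]//=; rewrite !lee_fin ler_norml => /andP[].
apply: has_mean_le hm (has_mean_cst _) _ => t.
by move: (fB t); case: (f t) => [r| |]//=; rewrite !lee_fin ler_norml => /andP[].
Qed.

Lemma circle_mean_rot F (u : R[i]) : modulus u = 1%R ->
  measurable_fun [set: R] (fun t => F (expi t)) ->
  circle_mean (fun t => F (u * expi t)%R) = circle_mean (fun t => F (expi t)).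
Proof.
move=> /expi_surj[c c2 <-] mF.
rewrite -(circle_mean_shift c2 mF); last by move=> t; rewrite expi_period.
by congr circle_mean; apply/funext => t; rewrite addrC expiD.
Qed.

Lemma circle_mean_pow F n : (0 < n)%N ->
  measurable_fun [set: R] (fun t => F (expi t)) ->
  circle_mean (fun t => F (expi t ^+ n)%R) = circle_mean (fun t => F (expi t)).
Proof.
move=> n0 mF.
rewrite -(circle_mean_muln n0 mF); last by move=> t; rewrite expi_period.
by congr circle_mean; apply/funext => t; rewrite expi_muln.
Qed.

End HasMean.

(** * Jensen's formula *)

Section Jensen.
Context {R : realType}.
Local Notation mu := (@lebesgue_measure R).
Local Notation I := `[0%R, (2 * pi)%R]%classic.
Local Open Scope ereal_scope.
Implicit Types a z w : R[i].

Lemma mlog_neq0 z : z != 0%R -> mlog z = (ln (modulus z))%:E.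
Proof. by move=> z0; rewrite /mlog lne_EFin// modulus_gt0. Qed.

Lemma mlog0 : mlog (0%R : R[i]) = -oo.
Proof. by rewrite /mlog modulus0 /= lexx. Qed.

Lemma mlogM z w : mlog (z * w)%R = mlog z + mlog w.
Proof.
have [->|z0] := eqVneq z 0%R; first by rewrite mul0r mlog0.
have [->|w0] := eqVneq w 0%R; first by rewrite mulr0 mlog0 addeNy.
by rewrite !mlog_neq0 ?mulf_neq0// modulusM lnM ?posrE ?modulus_gt0.
Qed.

Lemma le_mlog z w : (modulus z <= modulus w)%R -> mlog z <= mlog w.
Proof.
move=> zw; rewrite /mlog lee_lne// in_itv/= leey andbT lee_fin ?modulus_ge0//.
Qed.

Definition log_mean a := circle_mean (fun t => mlog (1 + a * expi t)%R).

Definition log_integrable a :=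
  mu.-integrable I (fun t => mlog (1 + a * expi t)%R).

Lemma cmeasurable_affine a c : cmeasurable (fun t : R => c + a * expi t)%R.
Proof.
apply: cmeasurableD; first exact: cmeasurable_cst.
by apply: cmeasurableM; [exact: cmeasurable_cst|exact: cmeasurable_expi].
Qed.

Lemma measurable_mlog_affine a c :
  measurable_fun [set: R] (fun t : R => mlog (c + a * expi t)%R).
Proof. exact/measurable_mlog/cmeasurable_affine. Qed.

Lemma log_mean_rot a u : modulus u = 1%R -> log_mean (a * u)%R = log_mean a.
Proof.
move=> u1; rewrite /log_mean.
rewrite -(@circle_mean_rot _ (fun z => mlog (1 + a * z)%R) u)//.
  by congr circle_mean; apply/funext => t; rewrite mulrA.
exact: measurable_mlog_affine.
Qed.

(** From (1 + a z) (1 - a z) = 1 - a^2 z^2: the mean is unchanged under z -> -z and under z -> z^2,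
    so squaring a doubles it. This replaces any use of holomorphy in Jensen's formula. *)
Lemma log_mean_double a : log_integrable a -> log_integrable (- a)%R ->
  log_mean (a ^+ 2)%R = (fine (log_mean a) + fine (log_mean a))%:E.
Proof.
move=> ia iNa.
have ma := integrable_has_mean ia; have mNa := integrable_has_mean iNa.
have N1 : modulus (-1 : R[i])%R = 1%R by rewrite modulusN modulus1.
have E : log_mean (- a)%R = log_mean a by rewrite -mulrN1 log_mean_rot.
have [_] := has_meanD ma mNa; rewrite -/(log_mean a) -/(log_mean (- a)%R) E => <-.
rewrite -(log_mean_rot _ N1) /log_mean.
rewrite -(@circle_mean_pow _ (fun z => mlog (1 + a ^+ 2 * -1 * z)%R) 2)//; last first.
  exact: measurable_mlog_affine.
congr circle_mean; apply/funext => t; rewrite -mlogM; congr mlog.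
by ring.
Qed.

(** The modulus lies between 1 - r and 1 + r, and 1 + r <= 1 / (1 - r). *)
Lemma log_bounded a (r : R) : (r < 1)%R -> (modulus a <= r)%R -> forall t : R,
  `|mlog (1 + a * expi t)%R| <= (- ln (1 - r))%:E.
Proof.
move=> r1 ar t; have r0 : (0 <= r)%R by rewrite (le_trans _ ar)// modulus_ge0.
set z := (1 + _)%R.
have lz : (1 - r <= modulus z)%R.
  have := modulusB 1%R (- (a * expi t))%R; rewrite opprK; apply: le_trans.
  by rewrite modulusN modulus1 lerB// modulusM modulus_expi mulr1.
have uz : (modulus z <= 1 + r)%R.
  by rewrite (le_trans (modulusD _ _))// modulus1 lerD2l modulusM modulus_expi mulr1.
have z0 : (0 < modulus z)%R by rewrite (lt_le_trans _ lz)// subr_gt0.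
rewrite mlog_neq0 -?modulus_gt0// lee_fin ler_norml opprK.
rewrite ler_ln ?posrE ?subr_gt0// lz/= -lnV ?posrE ?subr_gt0//.
rewrite ler_ln ?posrE ?invr_gt0 ?subr_gt0// (le_trans uz)//.
rewrite -[leRHS]mul1r ler_pdivlMr ?subr_gt0//; nra.
Qed.

(** Repeated squaring multiplies the mean m by 2^k, while the means at all a^(2^k) obey the same
    bound - ln (1 - |a|). Hence m = 0. *)
Lemma log_mean_lt1 a : (modulus a < 1)%R ->
  log_integrable a /\ log_mean a = 0.
Proof.
move=> a1; have mb b : (modulus b <= modulus a)%R ->
    exists2 m, has_mean (fun t => mlog (1 + b * expi t)%R) m
             & (`|m| <= - ln (1 - modulus a))%R.
  move=> ba; apply: bounded_has_mean; first exact: measurable_mlog_affine.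
  exact: log_bounded.
have [m [ia ma] mB] := mb a (lexx _); split => //.
rewrite /log_mean ma; congr EFin; apply/eqP; rewrite -normr_le0.
have dbl k : log_mean (a ^+ (2 ^ k)%N)%R = (m *+ (2 ^ k)%N)%:E.
  elim: k => [|k IH]; first by rewrite expn0 expr1 mulr1n.
  rewrite expnSr exprM; have ak : (modulus (a ^+ (2 ^ k)%N) <= modulus a)%R.
    rewrite modulusX -[leRHS]expr1 ler_wiXn2l ?modulus_ge0 ?(ltW a1)//.
    by rewrite expn_gt0.
  have [_ [i1 _] _] := mb _ ak.
  have [|_ [i2 _] _] := mb (- (a ^+ (2 ^ k)%N))%R; first by rewrite modulusN.
  by rewrite (log_mean_double i1 i2) IH/= -mulrnDr addnn -muln2.
apply/ler_addgt0Pl => e e0; rewrite addr0.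
set B := (- ln _)%R in mB mb.
have [k kB] : exists k : nat, (B / e <= (2 ^ k)%:R)%R.
  exists (Num.truncn (B / e)).+1; rewrite (le_trans (ltW (truncnS_gt _)))//.
  by rewrite ler_nat ltnW// ltn_expl.
have [|m' [_ mk] mB'] := mb (a ^+ (2 ^ k)%N)%R.
  by rewrite modulusX -[leRHS]expr1 ler_wiXn2l ?modulus_ge0 ?(ltW a1)// expn_gt0.
move: mk; rewrite -/(log_mean _) dbl => -[mE]; move: mB'; rewrite -mE.
rewrite normrMn -mulr_natr => mkB.
have k0 : (0 < (2 ^ k)%:R :> R)%R by rewrite ltr0n expn_gt0.
rewrite -(ler_pM2r k0) (le_trans mkB)// mulrC.
by rewrite -ler_pdivrMr.
Qed.

End Jensen.

(** * Jensen's formula for roots on the circle, then for all roots *)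

Section JensenBoundary.
Context {R : realType}.
Local Notation mu := (@lebesgue_measure R).
Local Notation I := `[0%R, (2 * pi)%R]%classic.
Local Open Scope ereal_scope.
Implicit Types a z w : R[i].

(** The limit 0 is included, as 1 + a e^(it) can vanish when |a| = 1. *)
Lemma cvg_lne (x_ : nat -> R) (x : R) : (0 <= x)%R -> x_ n @[n --> \oo] --> x ->
  lne (x_ n)%:E @[n --> \oo] --> lne x%:E.
Proof.
rewrite le_eqVlt => /orP[/eqP<-|x0] xx.
  rewrite [X in _ --> X](_ : _ = -oo); last by rewrite /= lexx.
  apply/cvgeNyPle => A.
  have /cvgrPdist_lt/(_ (expR A) (expR_gt0 _)) := xx.
  apply: filterS => n; rewrite sub0r normrN => xA; rewrite /=; case: ifPn => //.
    by rewrite leNye.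
  rewrite -ltNge => xn0; rewrite lee_fin -[A]expRK ler_ln ?posrE ?expR_gt0//.
  by rewrite (le_trans (ler_norm _))// ltW.
rewrite lne_EFin//.
have xn0 : \forall n \near \oo, (0 < x_ n)%R by exact: (cvgr_gt x).
have : (ln (x_ n))%:E @[n --> \oo] --> (ln x)%:E.
  apply: cvg_EFin; first by near=> n.
  exact: (continuous_cvg _ (continuous_ln x0)).
apply: cvg_trans; apply: near_eq_cvg.
by near=> n; rewrite lne_EFin//; near: n.
Unshelve. all: by end_near. Qed.

Lemma circle_mean_integral (f : R -> \bar R) (m : R) :
  circle_mean f = m%:E -> \int[mu]_(t in I) f t = (2 * pi * m)%:E.
Proof.
have p0 : (2 * pi != 0 :> R)%R by rewrite mulf_neq0// gt_eqF// pi_gt0.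
move=> /(congr1 (fun x => (2 * pi)%:E * x)).
by rewrite /circle_mean muleA -EFinM mulfV// mul1e.
Qed.

(** Fatou's lemma along the radii [r k] increasing to 1: the functions ln 2 - log |1 + r_k a e^(it)|
    are nonnegative, since the modulus is at most 2, and all have mean ln 2 by the case |a| < 1. *)
Lemma log_integrable_eq1 a : modulus a = 1%R -> log_integrable a.
Proof.
move=> a1; pose r k : R := (1 - k.+1%:R^-1)%R.
have r0 k : (0 <= r k)%R by rewrite subr_ge0 invf_le1// ler1n.
have r1 k : (r k < 1)%R by rewrite ltrBlDr ltrDl invr_gt0.
pose b k : R[i] := (real_complex R (r k) * a)%R.
have mb k : (modulus (b k) = r k)%R by rewrite modulusM a1 mulr1 modulus_real ger0_norm.
pose f k t := (ln 2)%:E - mlog (1 + b k * expi t)%R.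
have f_mean k : circle_mean (f k) = (ln 2)%:E.
  have [|ib mb0] := @log_mean_lt1 _ (b k); first by rewrite mb.
  have [_] := has_meanD (has_mean_cst (ln 2)) (has_meanN (conj ib mb0)).
  by rewrite oppr0 addr0.
have le2 c t : (modulus c <= 1)%R -> mlog (1 + c * expi t)%R <= (ln (2 : R))%:E.
  move=> c1; have -> : (ln (2 : R))%:E = mlog (real_complex R 2).
    by rewrite mlog_neq0 ?modulus_real ?gtr0_norm// -modulus_gt0 modulus_real normr_gt0.
  apply: le_mlog; rewrite modulus_real gtr0_norm// (le_trans (modulusD _ _))//.
  by rewrite modulus1 modulusM modulus_expi mulr1 (_ : 2 = 1 + 1)%R ?lerD2l// -[2%R]natr1.
have f0 k t : 0 <= f k t.
  by rewrite subre_ge0// le2// mb ltW.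
have mf c : measurable_fun [set: R] (fun t => (ln 2)%:E - mlog (1 + c * expi t)%R).
  by apply: emeasurable_funB; [exact: measurable_cst|exact: measurable_mlog_affine].
pose g t := (ln 2)%:E - mlog (1 + a * expi t)%R.
(* The convergence is in the extended sense: [g t] is +oo at a zero of 1 + a e^(it). *)
have fg t : limn_einf (fun k => f k t) = g t.
  apply: (cvg_limn_einf_sup _).1.
  apply: cvgeB; [by rewrite fin_num_adde_defr|exact: cvg_cst|].
  apply: cvg_lne; first exact: modulus_ge0.
  apply/cvgrPdist_le => e e0.
  have : (r k @[k --> \oo] --> (1 : R))%R.
    rewrite -[X in _ --> X]subr0; apply: cvgB; first exact: cvg_cst.
    exact: cvg_harmonic.
  move=> /cvgrPdist_le/(_ e e0); apply: filterS => k.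
  rewrite ger0_norm ?subr_ge0 ?(ltW (r1 k))// => ke.
  rewrite (le_trans _ ke)//.
  have D : (1 - r k = modulus ((1 + a * expi t) - (1 + b k * expi t)))%R.
    have -> : ((1 + a * expi t) - (1 + b k * expi t) =
       real_complex R (1 - r k) * (a * expi t))%R.
      by rewrite rmorphB rmorph1 /b; ring.
    by rewrite !modulusM a1 modulus_expi !mulr1 modulus_real ger0_norm// subr_ge0 ltW.
  by rewrite D modulus_dist.
have ig : mu.-integrable I g.
  apply/integrableP; split; first by apply: measurable_funTS; exact: mf.
  rewrite (_ : \int[mu]_(x in I) `|g x| = \int[mu]_(x in I) limn_einf (f ^~ x)); last first.
    by apply: eq_integral => t _; rewrite fg gee0_abs// subre_ge0// le2// a1.
  rewrite (le_lt_trans (fatou _ _ _ _))//.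
  - by move=> k; apply: measurable_funTS; exact: mf.
  - have /is_cvg_limn_einfE : cvgn (fun k => \int[mu]_(x in I) f k x).
      under eq_fun do rewrite (circle_mean_integral (f_mean _)).
      exact: is_cvg_cst.
    move=> ->; under eq_fun do rewrite (circle_mean_integral (f_mean _)).
    by rewrite lim_cst// ltry.
have [i2 _] := has_mean_cst (ln (2 : R)).
apply: eq_integrable (integrableB _ i2 ig) => // t _ /=; rewrite /g.
have := le2 a t; rewrite a1 => /(_ (lexx _)).
case: (mlog _) => [x| |]//= _.
by rewrite -!EFinB opprB addrC subrK.
Qed.

(** Replacing a by a^2 is now a rotation, which preserves the mean, and it also doubles the mean.
    The mean is finite, so it is 0. *)
Lemma log_mean_eq1 a : modulus a = 1%R -> log_mean a = 0.
Proof.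
move=> a1; have ia := log_integrable_eq1 a1.
have iNa : log_integrable (- a)%R by apply: log_integrable_eq1; rewrite modulusN.
have := log_mean_double ia iNa; rewrite expr2 log_mean_rot//.
have [_] := integrable_has_mean ia; rewrite -/(log_mean a) => -> [].
set m := fine _ => mm; congr EFin; lra.
Qed.

Lemma has_mean_mlog1 a : (modulus a <= 1)%R ->
  has_mean (fun t => mlog (1 + a * expi t)%R) 0.
Proof.
rewrite le_eqVlt => /orP[/eqP a1|a1].
  by split; [exact: log_integrable_eq1|exact: log_mean_eq1].
exact: log_mean_lt1.
Qed.

Lemma eq_has_mean (f g : R -> \bar R) m : f =1 g -> has_mean f m -> has_mean g m.
Proof. by move=> /funext ->. Qed.

(** For |w| <= 1, conjugation gives |e^(it) - w| = |1 - conj(w) e^(it)|; for |w| > 1, the factor -w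
    is taken out. Both cases end in [has_mean_mlog1]. *)
Lemma has_mean_mlogXsubC w : has_mean (fun t => mlog (expi t - w)%R)
  (ln (Num.max 1 (modulus w)))%R.
Proof.
have EJ t : (expi t * (expi t)^* = 1 :> R[i])%R.
  by rewrite -modulusM_conj modulus_expi expr1n.
have [w1|w1] := leP (modulus w) 1%R.
  rewrite ln1; have := @has_mean_mlog1 (- w^*)%R.
  rewrite modulusN modulus_conj => /(_ w1); apply: eq_has_mean => t.
  rewrite /mlog; congr (lne _%:E).
  rewrite -[LHS]modulus_conj rmorphD rmorph1 rmorphM rmorphN /= conjCK.
  rewrite -[RHS]mul1r -{1}(modulus_expi t) -(modulus_conj (expi t)).
  rewrite -modulusM; congr modulus.
  by rewrite mulrDr mulrN [(_^* * expi t)%R]mulrC EJ mulNr mulrC.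
have w0 : w != 0%R by rewrite -modulus_gt0 (lt_trans ltr01).
have /has_mean_mlog1 : (modulus (- w^-1) <= 1)%R.
  by rewrite modulusN modulusV invf_le1 ?ltW// (lt_trans ltr01).
move=> /(has_meanD (has_mean_cst (ln (modulus w)))); rewrite addr0.
apply: eq_has_mean => t; rewrite -mlog_neq0// -mlogM /mlog -modulusN.
by congr (lne (modulus _)%:E); field.
Qed.

Lemma has_mean_mlog_roots (c : R[i]) (ws : seq R[i]) : c != 0%R ->
  has_mean (fun t => mlog (c *: \prod_(w <- ws) ('X - w%:P)).[expi t])
    (ln (modulus c * \prod_(w <- ws) Num.max 1 (modulus w)))%R.
Proof.
move=> c0; elim: ws => [|w ws IH].
  rewrite !big_nil mulr1; apply: eq_has_mean (has_mean_cst _) => t.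
  by rewrite hornerZ hornerC mulr1 mlog_neq0.
have p1 (s : seq R[i]) : (0 < \prod_(w <- s) Num.max 1 (modulus w))%R.
  by apply: prodr_gt0 => x _; rewrite lt_max ltr01.
rewrite !big_cons mulrCA lnM ?posrE ?mulr_gt0 ?modulus_gt0 ?lt_max ?ltr01//.
apply: eq_has_mean (has_meanD (has_mean_mlogXsubC w) IH) => t.
by rewrite -mlogM !hornerZ hornerM hornerXsubC mulrCA.
Qed.

End JensenBoundary.

(** * Powers as mixtures of truncated logarithms *)

Section Tonelli.
Context {R : realType}.
Local Notation mu := (@lebesgue_measure R).
Local Open Scope ereal_scope.
Implicit Types f : R * R -> \bar R.

Lemma tonelli_on f (D E : set (measurableTypeR R)) : measurable D -> measurable E ->
  measurable_fun [set: R * R] f -> (forall z, 0 <= f z) ->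
  \int[mu]_(x in D) \int[mu]_(y in E) f (x, y) =
  \int[mu]_(y in E) \int[mu]_(x in D) f (x, y).
Proof.
move=> mD mE mf f0.
pose g : measurableTypeR R * measurableTypeR R -> \bar R := f \_ (D `*` E).
have mg : measurable_fun setT g.
  apply/(measurable_restrictT _ (measurableX mD mE)).
  exact: measurable_funTS mf.
have g0 z : 0 <= g z by rewrite /g patchE; case: ifP.
have gE x y : g (x, y) = if (x \in D) && (y \in E) then f (x, y) else 0.
  by rewrite /g patchE in_setX.
transitivity (\int[mu]_x \int[mu]_y g (x, y)).
  rewrite [LHS]integral_mkcond; apply: eq_integral => x _; rewrite patchE.
  case: ifPn => [xD|/negbTE xD]; last first.
    by under eq_integral do rewrite gE xD; rewrite integral0.
  rewrite [LHS]integral_mkcond; apply: eq_integral => y _.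
  by rewrite patchE gE xD.
rewrite (@fubini_tonelli _ _ _ _ R mu mu g mg g0) [RHS]integral_mkcond.
apply: eq_integral => y _; rewrite patchE.
case: ifPn => [yE|/negbTE yE]; last first.
  by under eq_integral do rewrite gE yE andbF; rewrite integral0.
rewrite [RHS]integral_mkcond; apply: eq_integral => x _.
by rewrite patchE gE yE andbT.
Qed.

Lemma measurable_integral_snd f (E : set (measurableTypeR R)) : measurable E ->
  measurable_fun [set: R * R] f -> (forall z, 0 <= f z) ->
  measurable_fun [set: R] (fun x => \int[mu]_(y in E) f (x, y)).
Proof.
move=> mE mf f0.
pose g : measurableTypeR R * measurableTypeR R -> \bar R := f \_ (setT `*` E).
have mg : measurable_fun setT g.
  apply/(measurable_restrictT _ (measurableX measurableT mE)).
  exact: measurable_funTS mf.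
have g0 z : 0 <= g z by rewrite /g patchE; case: ifP.
have <- : fubini_F mu g = fun x => \int[mu]_(y in E) f (x, y).
  apply/funext => x; rewrite /fubini_F [RHS]integral_mkcond.
  by apply: eq_integral => y _; rewrite /g !patchE in_setX/= in_setT.
exact: measurable_fun_fubini_tonelli_F.
Qed.

Lemma circle_mean_iterated f :
  measurable_fun [set: R * R] f -> (forall z, 0 <= f z) ->
  circle_mean (fun s => circle_mean (fun t => f (s, t))) =
  ((2 * pi)^-1)%:E * (((2 * pi)^-1)%:E *
    \int[mu]_(s in `[0%R, (2 * pi)%R]) \int[mu]_(t in `[0%R, (2 * pi)%R]) f (s, t)).
Proof.
move=> mf f0; rewrite {1}/circle_mean; congr (_ * _).
rewrite ge0_integralZl//=.
- by apply: measurable_funTS; exact: measurable_integral_snd.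
- by move=> x _; apply: integral_ge0 => y _ /=; exact: f0.
- by rewrite lee_fin invr_ge0 mulr_ge0// pi_ge0.
Qed.

Lemma circle_mean_tonelli f :
  measurable_fun [set: R * R] f -> (forall z, 0 <= f z) ->
  circle_mean (fun s => circle_mean (fun t => f (s, t))) =
  circle_mean (fun t => circle_mean (fun s => f (s, t))).
Proof.
move=> mf f0.
have mf' : measurable_fun [set: R * R] (f \o (fun z => (z.2, z.1))).
  by apply: measurableT_comp => //; exact: measurable_fun_pair measurable_snd measurable_fst.
rewrite circle_mean_iterated// [RHS](circle_mean_iterated mf'); last first.
  by move=> z; exact: f0.
by rewrite tonelli_on.
Qed.

End Tonelli.

(** * The mixing weight and its integral *)

Section PowerKernel.
Context {R : realType}.
Local Notation mu := (@lebesgue_measure R).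
Implicit Types p C c x v : R.

(* Weight for which a power is a mixture of truncated logarithms,
   the truncation level being the exponential of C - v. *)
Definition power_weight p C v := p ^+ 2 * expR (p * (C - v)).

(** For x > 0 this is the positive part of v - (C - ln x), and for x = 0 it is 0. Subtracting the
    truncation level makes it nonnegative and does not affect comparisons at fixed v. *)
Definition truncated_ln C x v := ln (Num.max x (expR (C - v))) - (C - v).

Lemma truncated_ln_ge0 C x v : 0 <= truncated_ln C x v.
Proof.
rewrite /truncated_ln subr_ge0 -[leLHS]expRK ler_ln ?posrE ?expR_gt0//.
  by rewrite le_max lexx orbT.
by rewrite lt_max expR_gt0 orbT.
Qed.

Lemma power_weight_ge0 p C v : 0 <= power_weight p C v.
Proof. by rewrite mulr_ge0 ?sqr_ge0 ?expR_ge0. Qed.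

Let F p C c v := - ((p * (v - c) + 1) * expR (p * (C - v))).

Let F_derive p C c v :
  is_derive v 1 (F p C c) (power_weight p C v * (v - c)).
Proof.
rewrite /F; apply: is_derive_eq.
rewrite /power_weight /GRing.scale/=; ring.
Qed.

(** With u = p (v - c) >= 0, the bound u + 1 <= 2 e^(u/2) costs only half of the exponential
    decay. *)
Let F_cvg p C c : 0 < p -> F p C c v @[v --> +oo] --> 0.
Proof.
move=> p0; rewrite -oppr0; apply: cvgN.
have K0 : 0 <= 2 * expR (p * C - p * c / 2) by rewrite mulr_ge0 ?expR_ge0.
apply: (@squeeze_cvgr _ _ _ _ (fun=> 0)
  (fun v => 2 * expR (p * C - p * c / 2) * expR (- (p / 2 * v)))).
- near=> v; have cv : c <= v by near: v; apply: nbhs_pinfty_ge; exact: num_real.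
  have u0 : 0 <= p * (v - c) by rewrite mulr_ge0 ?subr_ge0// ltW.
  rewrite mulr_ge0 ?expR_ge0 ?addr_ge0//=.
  apply: (@le_trans _ _ (2 * expR (p * (v - c) / 2) * expR (p * (C - v)))).
    rewrite ler_wpM2r ?expR_ge0//.
    have := expR_ge1Dx (p * (v - c) / 2); lra.
  by rewrite -!mulrA -!expRD ler_wpM2l// ler_expR; lra.
- exact: cvg_cst.
- rewrite -[X in _ --> X](mulr0 (2 * expR (p * C - p * c / 2))).
  apply: cvgM; first exact: cvg_cst.
  apply: (@cvg_comp _ _ _ (fun v => p / 2 * v) (fun x => expR (- x)) _ +oo).
    by apply: gt0_cvgMry; [rewrite divr_gt0|exact: cvg_id].
  exact: cvgr_expR.
Unshelve. all: by end_near. Qed.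

Lemma power_weight_integral p C c : 0 < p ->
  (\int[mu]_(v in `[c, +oo[) (power_weight p C v * (v - c))%:E =
   (expR (p * (C - c)))%:E)%E.
Proof.
move=> p0.
have dcont (f : R -> R) v : derivable f v 1 -> {for v, continuous f}.
  by move=> /derivable1_diffP/differentiable_continuous.
rewrite (@ge0_continuous_FTC2y _ _ (F p C c) c 0).
- by rewrite sub0e /F subrr mulr0 add0r mul1r EFinN oppeK.
- by move=> v cv; rewrite mulr_ge0 ?power_weight_ge0// subr_ge0.
- apply: continuous_subspaceT => v; apply: dcont; rewrite /power_weight.
  exact: ex_derive.
- exact: F_cvg.
- by move=> v _; have [] := F_derive p C c v.
- apply: cvg_at_right_filter; apply: dcont.
  by have [] := F_derive p C c c.
- by move=> v _; rewrite derive1E; have [] := F_derive p C c v.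
Qed.

Lemma measurable_power_weight p C : measurable_fun [set: R] (power_weight p C).
Proof.
apply: measurable_funM => //; apply: measurableT_comp => //.
by apply: measurable_funM => //; exact: measurable_funB.
Qed.

Lemma measurable_truncated_ln d (T : measurableType d) C (x v : T -> R) :
  measurable_fun [set: T] x -> measurable_fun [set: T] v ->
  measurable_fun [set: T] (fun t => truncated_ln C (x t) (v t)).
Proof.
move=> mx mv; have mCv : measurable_fun [set: T] (fun t => C - v t).
  exact: measurable_funB.
apply: measurable_funB => //; apply: measurableT_comp => //.
by apply: measurable_maxr => //; exact: measurableT_comp.
Qed.

Lemma powR_mixture p C x : 0 < p -> 0 <= x <= expR C ->
  (\int[mu]_(v in `[0%R, +oo[) (power_weight p C v * truncated_ln C x v)%:E =
   (x `^ p)%:E)%E.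
Proof.
move=> p0 /andP[]; rewrite le_eqVlt => /orP[/eqP<-|x0] xC.
  rewrite powR0 ?gt_eqF//; under eq_integral => v _.
    rewrite /truncated_ln max_r ?expR_ge0// expRK subrr mulr0; over.
  exact: integral0.
(* The integrand vanishes below the threshold c, and x <= e^C places c in the range of
   integration. *)
pose c := C - ln x.
have c0 : 0 <= c by rewrite subr_ge0 -[leRHS]expRK ler_ln ?posrE ?expR_gt0.
have -> : x `^ p = expR (p * (C - c)).
  by rewrite /powR gt_eqF// /c opprB addrCA subrr addr0.
have xE : x = expR (C - c) by rewrite /c opprB addrCA subrr addr0 lnK.
rewrite -(power_weight_integral _ _ p0).
rewrite [RHS]integral_mkcond [LHS]integral_mkcond; apply: eq_integral => v _.
rewrite !patchE !mem_setE !in_itv/= !andbT.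
have [v0|v0] := leP 0 v; last by rewrite leNgt (lt_le_trans v0).
rewrite /truncated_ln; have [cv|cv] := leP c v.
  rewrite max_l; last by rewrite xE ler_expR lerD2l lerN2.
  by rewrite xE expRK; congr (_ * _)%:E; lra.
rewrite max_r; last by rewrite xE ler_expR lerD2l lerN2 ltW.
by rewrite expRK subrr mulr0.
Qed.

End PowerKernel.

(** * From Mahler measures to p-norms *)

Section Transfer.
Context {R : realType}.
Local Notation mu := (@lebesgue_measure R).
Local Notation I := `[0%R, (2 * pi)%R]%classic.
Local Open Scope ereal_scope.
Implicit Types (P Q : {poly R[i]}) (p : R).

(** The logarithm of the Mahler measure, equal to -oo for the zero polynomial. *)
Definition mahler Q := circle_mean (fun t => mlog Q.[expi t]).

Lemma cmeasurable_circle Q : cmeasurable (fun t : R => Q.[expi t]).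
Proof. by apply: cmeasurable_horner; exact: cmeasurable_expi. Qed.

Lemma measurable_mlog_circle Q :
  measurable_fun [set: R] (fun t : R => mlog Q.[expi t]).
Proof. exact/measurable_mlog/cmeasurable_circle. Qed.

Lemma has_mean_mahler Q : Q != 0%R ->
  exists m, has_mean (fun t => mlog Q.[expi t]) m.
Proof.
move=> Q0; have [ws QE] := closed_field_poly_normal Q.
have := @has_mean_mlog_roots _ (lead_coef Q) ws.
by rewrite lead_coef_eq0 -QE => /(_ Q0) h; eexists; exact: h.
Qed.

Lemma mean_weight_gt0 : (0 < (2 * pi)^-1 :> R)%R.
Proof. by rewrite invr_gt0 mulr_gt0// pi_gt0. Qed.

Lemma circle_mean_pinfty : circle_mean (fun=> +oo) = +oo :> \bar R.
Proof.
rewrite /circle_mean integral_cst//= lebesgue_measure_itv/= lte_fin.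
rewrite mulr_gt0 ?pi_gt0// sube0 gt0_mulye ?lte_fin ?mulr_gt0 ?pi_gt0//.
by rewrite gt0_muley// lte_fin mean_weight_gt0.
Qed.

Lemma mahler0 : mahler 0 = -oo.
Proof.
rewrite /mahler; under eq_fun do rewrite horner0 mlog0.
rewrite /circle_mean integral_cst//= lebesgue_measure_itv/= lte_fin.
rewrite mulr_gt0 ?pi_gt0// sube0 gt0_mulNye ?lte_fin ?mulr_gt0 ?pi_gt0//.
by rewrite gt0_muleNy// lte_fin mean_weight_gt0.
Qed.

Lemma has_mean_mlog_linear (a b : R[i]) : a != 0%R ->
  has_mean (fun t => mlog (a * expi t + b)%R)
    (ln (Num.max (modulus a) (modulus b)))%R.
Proof.
move=> a0; have := has_mean_mlog_roots [:: (- (b / a))%R] a0.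
rewrite !big_seq1 maxr_pMr ?modulus_ge0// mulr1 modulusN modulusM modulusV.
rewrite mulrCA mulfV ?modulus_eq0// mulr1.
apply: eq_has_mean => t; rewrite hornerZ hornerXsubC; congr mlog.
by field.
Qed.

(** Tonelli's theorem is applied to nonnegative deficits B - log, which reverse the comparison. Zero
    polynomials must be allowed, because adding a constant can produce one. *)
Lemma mahler_deficit P Q (B : R) : mahler Q <= mahler P ->
  circle_mean (fun t => B%:E - mlog P.[expi t]) <=
  circle_mean (fun t => B%:E - mlog Q.[expi t]).
Proof.
have [->|Q0] := eqVneq Q 0%R.
  move=> _; rewrite [leRHS](_ : _ = +oo) ?leey//.
  under eq_fun do rewrite horner0 mlog0 /=.
  exact: circle_mean_pinfty.
have [q hq] := has_mean_mahler Q0.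
have [->|P0] := eqVneq P 0%R.
  by rewrite mahler0 leeNy_eq /mahler (proj2 hq).
have [m hm] := has_mean_mahler P0.
rewrite /mahler (proj2 hq) (proj2 hm) lee_fin => qm.
have [_ ->] := has_meanD (has_mean_cst B) (has_meanN hm).
have [_ ->] := has_meanD (has_mean_cst B) (has_meanN hq).
by rewrite lee_fin lerD2l lerN2.
Qed.

Lemma circle_bound Q : exists K : R, forall t, (modulus Q.[expi t] <= K)%R.
Proof.
elim/poly_ind: Q => [|Q c [K IH]].
  by exists 0%R => t; rewrite horner0 modulus0.
exists (K + modulus c)%R => t; rewrite hornerD hornerMX hornerC.
by rewrite (le_trans (modulusD _ _))// lerD2r modulusM modulus_expi mulr1.
Qed.

Lemma circle_bound_expR Q : exists C : R, forall t, (modulus Q.[expi t] <= expR C)%R.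
Proof.
have [K QK] := circle_bound Q; exists K => t; rewrite (le_trans (QK t))//.
by rewrite (le_trans _ (expR_ge1Dx _))// lerDr.
Qed.

Definition max_ln Q tau (t : R) := (ln (Num.max tau (modulus Q.[expi t])))%R.

Lemma measurable_max_ln Q tau : measurable_fun [set: R] (max_ln Q tau).
Proof.
apply: measurableT_comp => //; apply: measurable_maxr => //.
exact/measurable_modulus/cmeasurable_circle.
Qed.

Lemma max_ln_mean Q (tau : R) t : (0 < tau)%R ->
  has_mean (fun u => mlog (Q.[expi t] + real_complex R tau * expi u)%R)
    (max_ln Q tau t).
Proof.
move=> tau0; have c0 : real_complex R tau != 0%R.
  by rewrite -modulus_gt0 modulus_real gtr0_norm.
have := has_mean_mlog_linear Q.[expi t] c0.
rewrite modulus_real gtr0_norm//; apply: eq_has_mean => u.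
by rewrite addrC.
Qed.

Lemma max_ln_has_mean (T : {poly R[i]}) (tau B : R) : (0 < tau)%R ->
  (forall t, (modulus T.[expi t] + tau <= expR B)%R) ->
  exists m, has_mean (EFin \o max_ln T tau) m.
Proof.
move=> tau0 TB.
  have [|t|m hm _] := @bounded_has_mean _ (EFin \o max_ln T tau) (`|ln tau| + `|B|)%R.
  - by apply/measurable_EFinP; exact: measurable_max_ln.
  - move: t => s; rewrite lee_fin /max_ln.
    have mx0 : (0 < Num.max tau (modulus T.[expi s]))%R by rewrite lt_max tau0.
    have l1 : (ln tau <= ln (Num.max tau (modulus T.[expi s])))%R.
      by rewrite ler_ln ?posrE// le_max lexx.
    have l2 : (ln (Num.max tau (modulus T.[expi s])) <= B)%R.
      rewrite -[leRHS]expRK ler_ln ?posrE ?expR_gt0//.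
      rewrite (le_trans _ (TB s))// ge_max lerDr modulus_ge0 lerDl/= ltW//.
    rewrite ler_norml; apply/andP; split.
      rewrite (le_trans _ l1)//; have := ler_norm (- ln tau)%R; rewrite normrN.
      by have := normr_ge0 B; lra.
    rewrite (le_trans l2)//; have := ler_norm B; have := normr_ge0 (ln tau); lra.
  by exists m.
Qed.

(* The mean over u of log |x + tau e^(iu)| is log (max(tau, |x|)), so exchanging the two
   integrations reduces the claim to the polynomials Q + c with |c| = tau. *)
Lemma max_ln_le P Q (tau B : R) : (0 < tau)%R ->
  (forall c : R[i], mahler (Q + c%:P) <= mahler (P + c%:P)) ->
  (forall t, (modulus P.[expi t] + tau <= expR B)%R) ->
  (forall t, (modulus Q.[expi t] + tau <= expR B)%R) ->
  circle_mean (EFin \o max_ln Q tau) <= circle_mean (EFin \o max_ln P tau).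
Proof.
move=> tau0 hM PB QB.
(* The constant B makes this nonnegative, so the integrals can be exchanged although the logarithm
   is singular on a set depending on both variables. *)
pose d T (z : R * R) := B%:E - mlog (T.[expi z.1] + real_complex R tau * expi z.2)%R.
have md T : measurable_fun [set: R * R] (d T).
  apply: emeasurable_funB; first exact: measurable_cst.
  apply: measurable_mlog; apply: cmeasurableD.
    by apply: cmeasurable_horner; exact: (cmeasurable_expi measurable_fst).
  apply: cmeasurableM; first exact: cmeasurable_cst.
  exact: (cmeasurable_expi measurable_snd).
have d0 T : (forall t, (modulus T.[expi t] + tau <= expR B)%R) ->
    forall z, 0 <= d T z.
  move=> TB z; rewrite subre_ge0//.
  have -> : B%:E = mlog (real_complex R (expR B)).
    by rewrite mlog_neq0 -?modulus_gt0 modulus_real gtr0_norm ?expR_gt0// expRK.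
  apply: le_mlog; rewrite modulus_real gtr0_norm ?expR_gt0//.
  rewrite (le_trans (modulusD _ _))// modulusM modulus_expi mulr1 modulus_real.
  by rewrite gtr0_norm.
have dE T : (forall t, (modulus T.[expi t] + tau <= expR B)%R) ->
    circle_mean (fun s => circle_mean (fun t => d T (s, t))) =
    B%:E - circle_mean (EFin \o max_ln T tau).
  move=> TB.
  have -> : (fun s => circle_mean (fun t => d T (s, t))) =
      fun s => B%:E - (max_ln T tau s)%:E.
    apply/funext => s.
    by have [_ ->] := has_meanD (has_mean_cst B) (has_meanN (max_ln_mean T s tau0)).
  have [m hm] := max_ln_has_mean tau0 TB.
  have [_ ->] := has_meanD (has_mean_cst B) (has_meanN hm).
  by rewrite (proj2 hm).
have le_d : circle_mean (fun s => circle_mean (fun t => d P (s, t))) <=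
    circle_mean (fun s => circle_mean (fun t => d Q (s, t))).
  rewrite (circle_mean_tonelli (md P) (d0 _ PB)).
  rewrite (circle_mean_tonelli (md Q) (d0 _ QB)).
  have dT T t : (fun s => d T (s, t)) =
      fun s => B%:E - mlog (T + (real_complex R tau * expi t)%:P).[expi s].
    by apply/funext => s; rewrite hornerD hornerC.
  have c0 : (0 <= (2 * pi)^-1 :> R)%R by rewrite ltW ?mean_weight_gt0.
  have msnd T : (forall t, (modulus T.[expi t] + tau <= expR B)%R) ->
      measurable_fun [set: R] (fun t => circle_mean (fun s => d T (s, t))).
    move=> TB; apply: measurable_funeM.
    apply: (@measurable_integral_snd _ (d T \o (fun z => (z.2, z.1)))) => //.
      by apply: measurableT_comp => //; exact: measurable_fun_pair measurable_snd measurable_fst.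
    by move=> z; exact: d0.
  apply: ge0_le_circle_mean; [exact: msnd|exact: msnd| |].
  - move=> t; rewrite mule_ge0 ?lee_fin//; apply: integral_ge0 => s _.
    exact: d0.
  - by move=> t; rewrite !dT; exact: mahler_deficit.
have [[p hp] [q hq]] := (max_ln_has_mean tau0 PB, max_ln_has_mean tau0 QB).
move: le_d; rewrite !dE// (proj2 hp) (proj2 hq) -!EFinB !lee_fin.
by rewrite lerD2l lerN2.
Qed.

Lemma has_mean_powR p Q : (0 < p)%R -> exists2 m,
  has_mean (fun t => (modulus Q.[expi t] `^ p)%:E) m & (0 <= m)%R.
Proof.
move=> p0; have [C QC] := circle_bound_expR Q.
have [|t|m hm _] := @bounded_has_mean _
  (fun t => (modulus Q.[expi t] `^ p)%:E) (expR C `^ p)%R.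
- apply/measurable_EFinP; 
  apply: (@measurableT_comp _ _ _ _ _ _ (fun x : R => x `^ p)%R).
    exact: measurable_powR.
  exact/measurable_modulus/cmeasurable_circle.
- rewrite lee_fin ger0_norm ?powR_ge0// ge0_ler_powR ?nnegrE ?modulus_ge0 ?expR_ge0//.
  exact: ltW.
exists m => //; apply: has_mean_le (has_mean_cst 0) hm _ => t.
by rewrite lee_fin powR_ge0.
Qed.

Lemma circle_mean_le_integral (f g : R -> \bar R) :
  circle_mean f <= circle_mean g ->
  \int[mu]_(t in I) f t <= \int[mu]_(t in I) g t.
Proof. by rewrite /circle_mean lee_pmul2l// lte_fin mean_weight_gt0. Qed.

(** Both powers are expanded with the same weight and the same C. After the exchange of integrals it
    is enough to compare truncated logarithms at each fixed v; no convexity of x^p is used. *)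
Lemma circle_mean_powR_le p P Q : (0 < p)%R ->
  (forall c : R[i], mahler (Q + c%:P) <= mahler (P + c%:P)) ->
  circle_mean (fun t => (modulus Q.[expi t] `^ p)%:E) <=
  circle_mean (fun t => (modulus P.[expi t] `^ p)%:E).
Proof.
move=> p0 hM; have [[C1 PC] [C2 QC]] := (circle_bound_expR P, circle_bound_expR Q).
pose C := Num.max C1 C2.
have {}PC t : (modulus P.[expi t] <= expR C)%R.
  by rewrite (le_trans (PC t))// ler_expR le_max lexx.
have {}QC t : (modulus Q.[expi t] <= expR C)%R.
  by rewrite (le_trans (QC t))// ler_expR le_max lexx orbT.
pose f T (z : R * R) :=
  (power_weight p C z.2 * truncated_ln C (modulus T.[expi z.1]) z.2)%:E.
have f0 T z : 0 <= f T z.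
  by rewrite lee_fin mulr_ge0 ?power_weight_ge0 ?truncated_ln_ge0.
have mf T : measurable_fun [set: R * R] (f T).
  apply/measurable_EFinP; apply: measurable_funM.
    exact: (measurableT_comp (measurable_power_weight p C) measurable_snd).
  apply: measurable_truncated_ln => //.
  apply: measurable_modulus; apply: cmeasurable_horner.
  exact: (cmeasurable_expi measurable_fst).
have fE T : (forall t, (modulus T.[expi t] <= expR C)%R) ->
    circle_mean (fun t => (modulus T.[expi t] `^ p)%:E) =
    ((2 * pi)^-1)%:E *
    \int[mu]_(v in `[0%R, +oo[) \int[mu]_(t in I) f T (t, v).
  move=> TC; rewrite -tonelli_on// /circle_mean; congr (_ * _).
  apply: eq_integral => t _; rewrite -(@powR_mixture _ p C)//.
  by rewrite modulus_ge0/=.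
rewrite (fE _ QC) (fE _ PC) lee_pmul2l; last 2 first.
- by [].
- by rewrite lte_fin mean_weight_gt0.
have mint T : measurable_fun (`[0%R, +oo[%classic : set (measurableTypeR R))
    (fun v : R => \int[mu]_(t in I) f T (t, v)).
  apply: measurable_funTS.
  apply: (@measurable_integral_snd _ (f T \o (fun z => (z.2, z.1)))) => //.
    by apply: measurableT_comp => //; exact: measurable_fun_pair measurable_snd measurable_fst.
  by move=> z; exact: f0.
apply: ge0_le_integral => //.
- by move=> v _; apply: integral_ge0 => t _; exact: f0.
- move=> v _; rewrite /f/=.
  have wE T : \int[mu]_(t in I)
       (power_weight p C v * truncated_ln C (modulus T.[expi t]) v)%:E =
     (power_weight p C v)%:E *
       \int[mu]_(t in I) (truncated_ln C (modulus T.[expi t]) v)%:E.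
    under eq_integral do rewrite EFinM.
    rewrite ge0_integralZl//; last 3 first.
    - apply/measurable_EFinP; apply: measurable_funTS.
      apply: measurable_truncated_ln => //.
      exact/measurable_modulus/cmeasurable_circle.
    - by move=> t _; rewrite lee_fin truncated_ln_ge0.
    - by rewrite lee_fin power_weight_ge0.
  rewrite !wE lee_wpmul2l ?lee_fin ?power_weight_ge0//.
  apply: circle_mean_le_integral.
  pose tau := expR (C - v).
  have tau0 : (0 < tau)%R by exact: expR_gt0.
  (* From |T| <= e^C follows |T| + tau <= B <= e^B, the form of bound required by [max_ln_le]. *)
  pose B := (expR C + tau)%R.
  have BT T : (forall t, (modulus T.[expi t] <= expR C)%R) ->
      forall t, (modulus T.[expi t] + tau <= expR B)%R.
    move=> TC t; rewrite (le_trans _ (expR_ge1Dx _))// /B.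
    by have := TC t; lra.
  have := max_ln_le tau0 hM (BT _ PC) (BT _ QC).
  have [[a ha] [b hb]] := (max_ln_has_mean tau0 (BT _ PC), max_ln_has_mean tau0 (BT _ QC)).
  rewrite (proj2 ha) (proj2 hb) lee_fin => ba.
  have trE T : (fun t => (truncated_ln C (modulus T.[expi t]) v)%:E) =
      (fun t => (max_ln T tau t)%:E + (- (C - v))%:E).
    by apply/funext => t; rewrite /truncated_ln /max_ln maxC EFinB.
  rewrite !trE.
  have [_ ->] := has_meanD hb (has_mean_cst (- (C - v))).
  have [_ ->] := has_meanD ha (has_mean_cst (- (C - v))).
  by rewrite lee_fin lerD2r.
Qed.

Lemma pnorm_le_transfer p P Q : (0 <= p)%R ->
  (forall c : R[i], mahler (Q + c%:P) <= mahler (P + c%:P)) ->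
  (pnorm p Q <= pnorm p P)%R.
Proof.
move=> p0 hM; rewrite /pnorm; case: eqVneq => [_|pn0].
  (* For p = 0 the hypothesis at c = 0 is the claim itself; the zero polynomial gives [expeR -oo],
     which is 0 and hence finite. *)
  have := hM 0%R; rewrite !addr0 /mahler => h.
  have fin (T : {poly R[i]}) : expeR (circle_mean (fun t => mlog T.[expi t])) \is a fin_num.
    have [->|T0] := eqVneq T 0%R; last first.
      by have [m [_ ->]] := has_mean_mahler T0.
    by have := mahler0; rewrite /mahler => ->.
  by apply: fine_le; rewrite ?fin// lee_expeR.
have {}p0 : (0 < p)%R by rewrite lt_neqAle eq_sym pn0.
have [[a ha a0] [b hb b0]] := (has_mean_powR P p0, has_mean_powR Q p0).
have := circle_mean_powR_le p0 hM; rewrite (proj2 ha) (proj2 hb) lee_fin => ba.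
by rewrite ge0_ler_powR ?nnegrE// invr_ge0 ltW.
Qed.

End Transfer.

(** * Mahler measure inequalities *)

Section MahlerInequalities.
Context {R : realType}.
Implicit Types (P Q F G : {poly R[i]}) (z w : R[i]).

Lemma lipschitz_disc Q : exists2 K : R, 0 <= K &
  forall x y, modulus x <= 1 -> modulus y <= 1 ->
    modulus Q.[y] <= K /\ modulus (Q.[x] - Q.[y]) <= K * modulus (x - y).
Proof.
elim/poly_ind: Q => [|Q c [K K0 IH]].
  by exists 0 => // x y _ _; rewrite !horner0 subrr modulus0 mul0r.
exists (K + K + modulus c) => [|x y x1 y1].
  by rewrite !addr_ge0// modulus_ge0.
have [QyK QxyK] := IH x y x1 y1; rewrite !hornerD !hornerMX !hornerC.
have My := modulus_ge0 y; have Mc := modulus_ge0 c; have Mxy := modulus_ge0 (x - y).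
have MQ := modulus_ge0 Q.[y]; split.
  rewrite (le_trans (modulusD _ _))// lerD2r modulusM.
  by rewrite (@le_trans _ _ (K * 1)) ?ler_pM// mulr1 lerDl.
have -> : Q.[x] * x + c - (Q.[y] * y + c) = (Q.[x] - Q.[y]) * x + Q.[y] * (x - y).
  by ring.
rewrite (le_trans (modulusD _ _))// !modulusM !mulrDl.
rewrite -[leLHS]addr0 lerD ?mulr_ge0// lerD//.
  by rewrite -[leRHS]mulr1 ler_pM// modulus_ge0.
by rewrite ler_wpM2r.
Qed.

(** Grace-type bounds hold in the open disc, whereas means are taken on the circle; the point z is
    approached radially. *)
Lemma closed_disc_le F G :
  (forall y, modulus y < 1 -> modulus G.[y] <= modulus F.[y]) ->
  forall z, modulus z = 1 -> modulus G.[z] <= modulus F.[z].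
Proof.
move=> FG z z1; have [K1 K10 F1] := lipschitz_disc F.
have [K2 K20 G1] := lipschitz_disc G.
apply/ler_addgt0Pl => e e0.
pose K := K1 + K2 + 1; have K0 : 0 < K by rewrite /K; lra.
(* The bound 1/2 keeps 1 - d positive, and e / K makes the total Lipschitz error at most e. *)
pose d := Num.min (2^-1) (e / K).
have d0 : 0 < d by rewrite lt_min invr_gt0 ltr0n divr_gt0.
have d1 : d < 1 by rewrite gt_min; apply/orP; left; lra.
pose y := real_complex R (1 - d) * z.
have y1 : modulus y < 1.
  by rewrite modulusM z1 mulr1 modulus_real ger0_norm ?subr_ge0 ?ltW// ltrBlDr ltrDl.
have zy : modulus (z - y) = d.
  have -> : z - y = real_complex R d * z by rewrite /y rmorphB rmorph1; ring.
  by rewrite modulusM z1 mulr1 modulus_real gtr0_norm.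
have yz : modulus (y - z) = d by rewrite -modulusN opprB.
have z1le : modulus z <= 1 by rewrite z1.
have [_ Gzy] := G1 z y z1le (ltW y1).
have [_ Fyz] := F1 y z (ltW y1) z1le.
have Gz := modulusB G.[z] G.[y]; have Fy := modulusB F.[y] F.[z].
rewrite zy in Gzy; rewrite yz in Fyz.
have Kd : K * d <= e.
  by rewrite mulrC -ler_pdivlMr// ge_min lexx orbT.
have := FG _ y1; rewrite /K in Kd; lra.
Qed.

Lemma zero_free_real (r : R) P : (forall z, modulus z < r -> P.[z] != 0) ->
  zero_free (real_complex R r) P.
Proof. by move=> zf z; rewrite modulusE ltcR; exact: zf. Qed.

Lemma zero_free1 P : zero_free 1 P -> forall z, modulus z < 1 -> P.[z] != 0.
Proof. by move=> zf z z1; apply: zf; rewrite modulusE -(rmorph1 (real_complex R)) ltcR. Qed.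

Lemma prod_modulus (ws : seq R[i]) :
  modulus (\prod_(w <- ws) w) = \prod_(w <- ws) modulus w.
Proof.
by elim: ws => [|w ws IH]; rewrite ?big_nil ?modulus1// !big_cons modulusM IH.
Qed.

Lemma modulus_coef0_roots (c : R[i]) (ws : seq R[i]) :
  modulus (c *: \prod_(w <- ws) ('X - w%:P))`_0 =
  modulus c * \prod_(w <- ws) modulus w.
Proof.
rewrite -horner_coef0 hornerZ modulusM; congr (_ * _).
elim: ws => [|w ws IH]; first by rewrite !big_nil hornerC modulus1.
by rewrite !big_cons hornerM hornerXsubC sub0r modulusM modulusN IH.
Qed.

(** All roots have modulus at least 1, so the product of the max(1, |w|) is the product of the
    |w|. *)
Lemma mahler_zero_free Q : zero_free 1 Q ->
  has_mean (fun t => mlog Q.[expi t]) (ln (modulus Q`_0)).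
Proof.
move=> /zero_free1 zf; have [ws QE] := closed_field_poly_normal Q.
have Q0 : lead_coef Q != 0.
  rewrite lead_coef_eq0; apply/eqP => Q0; have := zf 0.
  by rewrite modulus0 ltr01 Q0 horner0 eqxx => /(_ isT).
have := has_mean_mlog_roots ws Q0; rewrite -QE.
suff -> : modulus Q`_0 = modulus (lead_coef Q) *
    \prod_(w <- ws) Num.max 1 (modulus w) by [].
rewrite {1}QE modulus_coef0_roots; congr (_ * _).
apply: eq_big_seq => w wws; rewrite max_r// leNgt; apply/negP => /zf.
by rewrite QE hornerZ mulf_eq0 (negbTE Q0)/= -/(root _ _) root_prod_XsubC wws.
Qed.

Lemma modulus_reflect_roots0 (c : R[i]) ws : modulus (reflect_roots c ws)`_0 =
  modulus c * \prod_(w <- ws) Num.max 1 (modulus w).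
Proof.
apply: (@complexI R); rewrite -modulusE norm_reflect_roots0 rmorphM rmorph_prod.
congr (_ * _).
apply: eq_bigr => w _.
rewrite modulusE -(rmorph1 (real_complex R)) ltcR.
by case: ltP.
Qed.

(** On the circle the image of P is dominated by the image of the reflected polynomial. The latter
    is zero free, so its Mahler measure is the modulus of its constant coefficient, which the
    operator preserves and which equals the Mahler measure of P. *)
Lemma mahler_arestov n s w P : (0 < s <= n)%N -> (size P <= n.+1)%N ->
  modulus w = 1 -> (mahler (arestov n s w P) <= mahler P)%E.
Proof.
move=> sn sP w1.
have [->|A0] := eqVneq (arestov n s w P) 0; first by rewrite mahler0 leNye.
have [P0|P0] := eqVneq P 0.
  by move: A0; rewrite P0 -polyC0 arestov_const ?eqxx//; case/andP: sn.
have [ws PE] := closed_field_poly_normal P.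
have c0 : lead_coef P != 0 by rewrite lead_coef_eq0.
set c := lead_coef P in PE c0.
have sws : (size ws <= n)%N.
  by rewrite -ltnS (leq_trans _ sP)// PE size_scale// size_prod_XsubC.
have w1' : `|w| <= 1 by rewrite modulusE w1.
have hP := has_mean_mlog_roots ws c0; rewrite -PE in hP.
have zfA : zero_free 1 (arestov n s w (reflect_roots c ws)).
  apply: arestov_zero_free => //; last exact: reflect_roots_zero_free.
  exact: leq_trans (size_reflect_roots _ _) _.
have hA := mahler_zero_free zfA.
rewrite coef0_arestov in hA; last by case/andP: sn.
rewrite modulus_reflect_roots0 in hA.
have [a ha] := has_mean_mahler A0.
rewrite /mahler (proj2 hP) (proj2 ha) lee_fin.
apply: has_mean_le ha hA _ => t; apply: le_mlog.
apply: closed_disc_le; last exact: modulus_expi.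
move=> y y1; rewrite le_modulus PE; apply: arestov_reflect_le => //.
by rewrite modulusE -(rmorph1 (real_complex R)) ltcR.
Qed.

(** The left side corresponds to max(|a_n|, |a_0|), where |a_0| is |a_n| times the product of the
    |w|; both are at most |a_n| times the product of the max(1, |w|). *)
Lemma mahler_ends n P : (0 < n)%N -> size P = n.+1 ->
  (mahler (P`_n *: 'X + (P`_0)%:P) <= mahler P)%E.
Proof.
move=> n0 sP; have [ws PE] := closed_field_poly_normal P.
have lP : lead_coef P = P`_n by rewrite lead_coefE sP.
have c0 : lead_coef P != 0 by rewrite lead_coef_eq0 -size_poly_eq0 sP.
have hP := has_mean_mlog_roots ws c0; rewrite -PE in hP.
have hL := has_mean_mlog_linear P`_0 c0.
have -> : mahler (P`_n *: 'X + (P`_0)%:P) =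
    circle_mean (fun t => mlog (lead_coef P * expi t + P`_0)).
  congr circle_mean; apply/funext => t.
  by rewrite hornerD hornerZ hornerX hornerC lP.
rewrite /mahler (proj2 hP) (proj2 hL) lee_fin.
have p1 (s : seq R[i]) : 1 <= \prod_(w <- s) Num.max 1 (modulus w).
  elim: s => [|x s IH]; first by rewrite big_nil.
  by rewrite big_cons -[leLHS]mulr1 ler_pM// le_max lexx.
have c0' : 0 < modulus (lead_coef P) by rewrite modulus_gt0.
rewrite ler_ln ?posrE ?mulr_gt0 ?(lt_le_trans ltr01 (p1 _))//; last first.
  by rewrite lt_max c0'.
rewrite ge_max ler_peMr ?p1 ?(ltW c0')//= {1}PE modulus_coef0_roots.
rewrite ler_pM2l//; elim: (ws) => [|x s IH]; first by rewrite !big_nil.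
rewrite !big_cons ler_pM ?modulus_ge0//; last by rewrite le_max lexx orbT.
by rewrite -prod_modulus modulus_ge0.
Qed.

End MahlerInequalities.

(** * The coefficient inequality *)

Section Assembly.
Context {R : realType}.
Implicit Types (P Q : {poly R[i]}) (z w : R[i]) (p k rho : R).
Local Notation rc := (real_complex R).

Definition power_mean p Q := fine (circle_mean (fun t => (modulus Q.[expi t] `^ p)%:E)).

Lemma power_meanE p Q : 0 < p ->
  circle_mean (fun t => (modulus Q.[expi t] `^ p)%:E) = (power_mean p Q)%:E.
Proof. by move=> p0; rewrite /power_mean; have [m [_ ->] _] := has_mean_powR Q p0. Qed.

Lemma power_mean_ge0 p Q : 0 < p -> 0 <= power_mean p Q.
Proof.
by move=> p0; rewrite /power_mean; have [m [_ ->] m0] := has_mean_powR Q p0.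
Qed.

Lemma has_power_mean p Q : 0 < p ->
  has_mean (fun t => (modulus Q.[expi t] `^ p)%:E) (power_mean p Q).
Proof. by move=> p0; have [m hm _] := has_mean_powR Q p0; rewrite /power_mean (proj2 hm). Qed.

Lemma pnormE p Q : 0 < p -> pnorm p Q = power_mean p Q `^ p^-1.
Proof. by move=> p0; rewrite /pnorm gt_eqF. Qed.

Lemma pnorm0E Q m : has_mean (fun t => mlog Q.[expi t]) m -> pnorm 0 Q = expR m.
Proof. by move=> [_ h]; rewrite /pnorm eqxx -/(mlog _) h. Qed.

Lemma pnorm_ge0 p Q : 0 <= pnorm p Q.
Proof.
rewrite /pnorm; case: ifP => _; last exact: powR_ge0.
by rewrite fine_ge0// expeR_ge0.
Qed.

Lemma high_part_le n s rho P z : (0 < s <= n)%N -> (size P <= n.+1)%N ->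
  (forall y, modulus y < rho -> P.[y] != 0) -> modulus z < rho ->
  rho ^+ s * modulus (high_part n s P).[z] <= modulus (low_part n s P).[z].
Proof.
move=> sn sP zf zr; have r0 : 0 < rho by rewrite (le_lt_trans _ zr)// modulus_ge0.
have := grace_le sn sP (zero_free_real zf) (z := z).
rewrite !modulusE ltcR => /(_ zr).
by rewrite -rmorphXn -rmorphM lecR.
Qed.

Lemma ends_le n P p : (0 < n)%N -> size P = n.+1 -> 0 <= p ->
  pnorm p (P`_n *: 'X + (P`_0)%:P) <= pnorm p P.
Proof.
move=> n0 sP p0; apply: pnorm_le_transfer => // c.
have sPc : size (P + c%:P) = n.+1.
  rewrite size_polyDl// sP (leq_ltn_trans (size_polyC_leq1 _))//.
have En : (P + c%:P)`_n = P`_n by rewrite coefD coefC (gtn_eqF n0) addr0.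
have E0 : (P + c%:P)`_0 = P`_0 + c by rewrite coefD coefC eqxx.
by have := mahler_ends n0 sPc; rewrite En E0 polyCD addrA.
Qed.

Lemma arestov_le n s w P p : (0 < s <= n)%N -> (size P <= n.+1)%N ->
  modulus w = 1 -> 0 < p ->
  (circle_mean (fun t => (modulus (arestov n s w P).[expi t] `^ p)%:E) <=
   (power_mean p P)%:E)%E.
Proof.
move=> sn sP w1 p0; rewrite -(power_meanE P p0); apply: circle_mean_powR_le => // c.
have sPc : (size (P + c%:P)%R <= n.+1)%N.
  by rewrite (leq_trans (size_polyD _ _))// geq_max sP (leq_trans (size_polyC_leq1 _)).
have := mahler_arestov sn sPc w1.
have s0 : (0 < s)%N by case/andP: sn.
have E : arestov n s w (P + c%:P) = arestov n s w P + c%:P.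
  by rewrite -{1}[c%:P]scale1r arestovD scale1r arestov_const.
by rewrite E.
Qed.

Lemma modulus_addr_expi (x t : R) :
  modulus (rc x + expi t) ^+ 2 = x ^+ 2 + x * cos t *+ 2 + 1.
Proof.
rewrite /modulus/= sqr_sqrtr ?addr_ge0 ?sqr_ge0// add0r.
by rewrite sqrrD -addrA cos2Dsin2.
Qed.

(** The squares differ by (y - x) (x + y + 2 cos t), and x + y >= 2 compensates the cosine. *)
Lemma modulus_addr_expi_mono (x y t : R) : 1 <= x <= y ->
  modulus (rc x + expi t) <= modulus (rc y + expi t).
Proof.
move=> /andP[x1 xy]; rewrite -ler_sqr ?nnegrE ?modulus_ge0//.
rewrite !modulus_addr_expi lerD2r -subr_ge0.
have -> : y ^+ 2 + y * cos t *+ 2 - (x ^+ 2 + x * cos t *+ 2) =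
    (y - x) * (x + y + 2 * cos t) by ring.
by rewrite mulr_ge0 ?subr_ge0//; have := cos_geN1 t; lra.
Qed.

Lemma modulus_pow_measurable Q p :
  measurable_fun [set: R] (fun t => (modulus Q.[expi t] `^ p)%:E).
Proof.
apply/measurable_EFinP; apply: (@measurableT_comp _ _ _ _ _ _ (fun x : R => x `^ p)).
  exact: measurable_powR.
exact/measurable_modulus/cmeasurable_circle.
Qed.

(** Up to a rotation of t, |u + e^(it) v| is |v| times | |u| / |v| + e^(it) |, and |u| / |v| >= k >=
    1 allows monotonicity. *)
Lemma power_mean_add_le k p u v : 0 < p -> 1 <= k ->
  k * modulus v <= modulus u ->
  ((modulus v `^ p * power_mean p (k%:C%C%:P + 'X))%:E <=
   circle_mean (fun t => (modulus (u + expi t * v) `^ p)%:E))%E.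
Proof.
move=> p0 k1 kuv; have [->|v0] := eqVneq v 0.
  rewrite modulus0 powR0 ?gt_eqF// mul0r -(circle_mean_cst 0).
  apply: ge0_le_circle_mean => //; last by move=> t; rewrite lee_fin powR_ge0.
  have := modulus_pow_measurable u%:P p; apply: eq_measurable_fun => t _.
  by rewrite hornerC mulr0 addr0.
have Mv : 0 < modulus v by rewrite modulus_gt0.
have Mu : 0 < modulus u by rewrite (lt_le_trans _ kuv)// mulr_gt0// (lt_le_trans ltr01).
have u0 : u != 0 by rewrite -modulus_gt0.
(* The quotient of the phases of v and u, removed below by rotation invariance. *)
pose al := (v / rc (modulus v)) / (u / rc (modulus u)).
have rcv : rc (modulus v) != 0 by rewrite -modulus_gt0 modulus_real gtr0_norm.
have rcu : rc (modulus u) != 0 by rewrite -modulus_gt0 modulus_real gtr0_norm.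
have al1 : modulus al = 1.
  rewrite /al !modulusM !modulusV !modulusM !modulusV !modulus_real.
  by rewrite !gtr0_norm// !divff ?gt_eqF// invr1 mulr1.
have uvE t : modulus (u + expi t * v) =
    modulus v * modulus (rc (modulus u / modulus v) + al * expi t).
  have -> : u + expi t * v = (u / rc (modulus u)) * rc (modulus v) *
      (rc (modulus u / modulus v) + al * expi t).
    rewrite /al rmorphM fmorphV; field.
    by rewrite u0 rcv rcu.
  by rewrite !modulusM modulusV !modulus_real !gtr0_norm// divff ?gt_eqF// mul1r.
have -> : (fun t => (modulus (u + expi t * v) `^ p)%:E) =
    fun t => (modulus ((modulus v)%:C%C *:
      ((rc (modulus u / modulus v))%:P + 'X)).[al * expi t] `^ p)%:E.
  apply/funext => t; rewrite uvE hornerZ hornerD hornerC hornerX.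
  by rewrite modulusM modulus_real gtr0_norm.
rewrite (@circle_mean_rot _ (fun z => (modulus ((modulus v)%:C%C *:
  ((rc (modulus u / modulus v))%:P + 'X)).[z] `^ p)%:E) al al1); last first.
  exact: modulus_pow_measurable.
have h1 := has_power_mean ((modulus v)%:C%C *: (k%:C%C%:P + 'X)) p0.
have h2 := has_power_mean (k%:C%C%:P + 'X) p0.
have -> : ((modulus v `^ p * power_mean p (k%:C%C%:P + 'X))%:E =
    circle_mean (fun t =>
      (modulus ((modulus v)%:C%C *: (k%:C%C%:P + 'X)).[expi t] `^ p)%:E))%E.
  rewrite EFinM -(proj2 h2) /circle_mean muleCA; congr (_ * _)%E.
  rewrite -ge0_integralZl//.
  - by apply: eq_integral => t _; rewrite hornerZ modulusM modulus_real
      (gtr0_norm Mv) powRM ?modulus_ge0.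
  - by apply: measurable_funTS; exact: modulus_pow_measurable.
  - by move=> t _; rewrite lee_fin powR_ge0.
  - by rewrite lee_fin powR_ge0.
apply: ge0_le_circle_mean; try exact: modulus_pow_measurable.
  by move=> t; rewrite lee_fin powR_ge0.
move=> t; rewrite lee_fin ge0_ler_powR ?nnegrE ?modulus_ge0 ?(ltW p0)//.
rewrite !hornerZ !modulusM ler_wpM2l ?modulus_ge0// !hornerD !hornerC !hornerX.
by apply: modulus_addr_expi_mono; rewrite k1 ler_pdivlMr.
Qed.

(** The double mean of |U + w z^s V|^p is estimated in both orders: for fixed w the mean over z is
    at most that of P, and for fixed z the mean over w is bounded below by [power_mean_add_le]. *)
Lemma low_high_power_mean n s rho P p : 1 <= rho -> (0 < s <= n)%N ->
  (size P <= n.+1)%N -> (forall y, modulus y < rho -> P.[y] != 0) -> 0 < p ->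
  power_mean p (high_part n s P) * power_mean p ((rc rho ^+ s)%:P + 'X) <=
  power_mean p P.
Proof.
move=> rho1 sn sP zf p0; have rhos : 1 <= rho ^+ s by rewrite exprn_ege1.
(* For rho = 1 the circle is the boundary of the zero-free disc, hence the passage through
   [closed_disc_le]. *)
have hU t : rho ^+ s * modulus (high_part n s P).[expi t] <=
    modulus (low_part n s P).[expi t].
  have := @closed_disc_le _ (low_part n s P) (rc (rho ^+ s) *: high_part n s P) _ (expi t).
  rewrite hornerZ modulusM modulus_real ger0_norm ?exprn_ge0 ?(le_trans ler01)//.
  apply; last exact: modulus_expi.
  move=> y y1; rewrite hornerZ modulusM modulus_real ger0_norm ?exprn_ge0 ?(le_trans ler01)//.
  by apply: (high_part_le sn sP zf); rewrite (lt_le_trans y1).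
pose U := low_part n s P; pose V := high_part n s P.
pose f (z : R * R) :=
  (modulus (U.[expi z.1] + expi z.2 * (expi z.1 ^+ s * V.[expi z.1])) `^ p)%:E.
have mf : measurable_fun [set: R * R] f.
  apply/measurable_EFinP; apply: (@measurableT_comp _ _ _ _ _ _ (fun x : R => x `^ p)).
    exact: measurable_powR.
  apply: measurable_modulus; have c1 := cmeasurable_expi (@measurable_fst _ _ R R).
  have c2 := cmeasurable_expi (@measurable_snd _ _ R R).
  apply: cmeasurableD; first exact: cmeasurable_horner.
  apply: cmeasurableM => //; apply: cmeasurableM; last exact: cmeasurable_horner.
  have := cmeasurable_horner 'X^s c1.
  by under eq_fun do rewrite hornerXn.
have f0 (z : R * R) : (0 <= f z)%E by rewrite lee_fin powR_ge0.
have msnd : measurable_fun [set: R] (fun t => circle_mean (fun r => f (r, t))).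
  apply: measurable_funeM.
  apply: (@measurable_integral_snd _ (f \o (fun q => (q.2, q.1)))) => //.
    by apply: measurableT_comp => //; exact: measurable_fun_pair measurable_snd measurable_fst.
  by move=> z; exact: f0.
have hP : (circle_mean (fun t => circle_mean (fun r => f (r, t))) <=
    (power_mean p P)%:E)%E.
  rewrite -(circle_mean_cst (power_mean p P)); apply: ge0_le_circle_mean => //.
  - move=> t; rewrite mule_ge0 ?lee_fin ?(ltW mean_weight_gt0)//.
    by apply: integral_ge0 => r _; exact: f0.
  - move=> t; apply: le_trans (arestov_le sn sP (modulus_expi t) p0).
    rewrite le_eqVlt; apply/orP; left; apply/eqP; congr circle_mean; apply/funext => r.
    by rewrite /f/= /arestov hornerD hornerZ hornerM hornerXn.
rewrite -lee_fin; apply: le_trans hP; rewrite -circle_mean_tonelli//.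
have hV := has_power_mean V p0.
rewrite [X in X%:E]mulrC EFinM -(proj2 hV) {1 2}/circle_mean muleCA.
rewrite lee_pmul2l; last 2 first.
- by [].
- by rewrite lte_fin mean_weight_gt0.
rewrite -ge0_integralZl//; last 3 first.
- by apply: measurable_funTS; exact: modulus_pow_measurable.
- by move=> t _; rewrite lee_fin powR_ge0.
- by rewrite lee_fin power_mean_ge0.
apply: ge0_le_integral; first exact: measurable_itv.
- by move=> t _; rewrite mule_ge0 ?lee_fin ?powR_ge0 ?power_mean_ge0.
- by apply: measurable_funTS; apply: measurable_funeM; exact: modulus_pow_measurable.
- apply: measurable_funTS; apply: measurable_funeM.
  exact: measurable_integral_snd.
- move=> t _; rewrite -EFinM mulrC.
  have := @power_mean_add_le (rho ^+ s) p U.[expi t] (expi t ^+ s * V.[expi t]) p0 rhos.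
  rewrite modulusM modulusX modulus_expi expr1n mul1r => /(_ (hU t)).
  by rewrite rmorphXn.
Qed.

Lemma powR_sum_ge1 (x y p : R) : 0 < p -> 0 <= x -> 0 <= y -> 2 <= x + y ->
  1 <= x `^ p + y `^ p.
Proof.
move=> p0 x0 y0 xy.
have pw (a : R) : 1 <= a -> 1 <= a `^ p.
  by move=> a1; rewrite -(powRr0 a) ler_powR// ltW.
have [x1|x1] := leP 1 x.
  by rewrite (le_trans (pw x x1))// lerDl powR_ge0.
have y1 : 1 <= y by lra.
by rewrite (le_trans (pw y y1))// lerDr powR_ge0.
Qed.

Lemma modulus_antipodes_ge2 k z : 1 <= k ->
  2 <= modulus (rc k + z) + modulus (rc k - z).
Proof.
move=> k1; apply: le_trans (modulusD _ _).
rewrite addrACA subrr addr0 -rmorphD modulus_real.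
by rewrite (le_trans _ (ler_norm _))// -[2]natr1 lerD.
Qed.

(** At antipodal points the moduli of k + z and k - z add up to at least 2, so one of them is at
    least 1. As both have the same mean power, that mean is at least 1/2. For p = 0 Jensen's formula
    gives a positive value. *)
Lemma pnorm_addX_gt0 k p : 1 <= k -> 0 <= p -> 0 < pnorm p ((rc k)%:P + 'X).
Proof.
move=> k1; rewrite le_eqVlt => /orP[/eqP<-|p0].
  have := @has_mean_mlog_linear R 1 (rc k) (oner_neq0 _).
  move=> h; rewrite (@pnorm0E _ (ln (Num.max (modulus 1) (modulus (rc k))))) ?expR_gt0//.
  by apply: eq_has_mean h => t; rewrite mul1r hornerD hornerX hornerC addrC.
rewrite pnormE// powR_gt0//.
set Q := _ + 'X; have h1 := has_power_mean Q p0.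
have h2 := has_power_mean ((rc k)%:P - 'X) p0.
have E : power_mean p ((rc k)%:P - 'X) = power_mean p Q.
  have N1 : modulus (-1 : R[i]) = 1 by rewrite modulusN modulus1.
  apply: (congr1 fine).
  rewrite -[RHS](@circle_mean_rot _ (fun z => (modulus Q.[z] `^ p)%:E) _ N1).
    apply: (congr1 (@circle_mean R)); apply/funext => t.
    by rewrite /Q !hornerD hornerN !hornerC !hornerX mulN1r.
  exact: modulus_pow_measurable.
rewrite E in h2.
have m2 : 1 <= power_mean p Q + power_mean p Q.
  apply: has_mean_le (has_mean_cst 1) (has_meanD h1 h2) _ => t.
  rewrite -EFinD lee_fin; apply: powR_sum_ge1 p0 (modulus_ge0 _) (modulus_ge0 _) _.
  by rewrite /Q !hornerD hornerN !hornerC !hornerX; exact: modulus_antipodes_ge2.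
by rewrite -(pmulrn_lgt0 _ (isT : 0 < 2)%N) mulr2n (lt_le_trans ltr01).
Qed.

Lemma low_high_pnorm n s rho P p : 1 <= rho -> (0 < s < n)%N ->
  size P = n.+1 -> (forall y, modulus y < rho -> P.[y] != 0) -> 0 <= p ->
  pnorm p (P`_n *: 'X + (P`_s / 'C(n, s)%:R)%:P) *
    pnorm p ((rc rho ^+ s)%:P + 'X) <= pnorm p P.
Proof.
move=> rho1 /andP[s0 sn] sP zf; have s0n : (0 < s <= n)%N by rewrite s0 ltnW.
have rhos : 1 <= rho ^+ s by rewrite exprn_ege1.
have rho0 : 0 < rho by rewrite (lt_le_trans ltr01).
have sP' : (size P <= n.+1)%N by rewrite sP.
have Pn : P`_n != 0 by have := lead_coef_eq0 P; rewrite lead_coefE sP -size_poly_eq0 sP => ->.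
have V0 : (high_part n s P)`_0 = P`_s / 'C(n, s)%:R.
  by rewrite coef_binomial_poly bin0 add0n mulr1n.
rewrite le_eqVlt => /orP[/eqP<-|p0].
  have zf1 : zero_free 1 P.
    move=> z; rewrite modulusE -(rmorph1 (real_complex R)) ltcR => z1.
    by apply: zf; rewrite (lt_le_trans z1).
  rewrite (pnorm0E (mahler_zero_free zf1)).
  have P0 : 0 < modulus P`_0.
    by rewrite modulus_gt0 -horner_coef0 zf// modulus0.
  have h1 := has_mean_mlog_linear (P`_s / 'C(n, s)%:R) Pn.
  have h2 := has_mean_mlog_linear (rc (rho ^+ s)) (oner_neq0 R[i]).
  rewrite (@pnorm0E (P`_n *: 'X + _)
    (ln (Num.max (modulus P`_n) (modulus (P`_s / 'C(n, s)%:R))))); last first.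
    by apply: eq_has_mean h1 => t; rewrite hornerD hornerZ hornerX hornerC.
  rewrite (@pnorm0E ((rc rho ^+ s)%:P + 'X)
    (ln (Num.max (modulus 1) (modulus (rc (rho ^+ s)))))); last first.
    by apply: eq_has_mean h2 => t; rewrite mul1r hornerD hornerX hornerC addrC rmorphXn.
  rewrite modulus1 modulus_real ger0_norm ?exprn_ge0 ?(ltW rho0)// (max_r rhos).
  have M0 : 0 < Num.max (modulus P`_n) (modulus (P`_s / 'C(n, s)%:R)).
    by rewrite lt_max modulus_gt0 Pn.
  have rhos0 : 0 < rho ^+ s by rewrite exprn_gt0.
  rewrite lnK; last by rewrite posrE.
  rewrite lnK; last by rewrite posrE.
  rewrite lnK; last by rewrite posrE.
  have lowE m : (low_part n m P).[0] = P`_0 by rewrite horner_coef0 coef0_low_part.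
  (* For p = 0 the three norms are max(|a_n|, |a_s / C(n, s)|), rho^s and |a_0|. The two required
     bounds are Grace's inequality at 0, with index n here (and rho^s <= rho^n) and with index s
     next. *)
  have Pn_le : rho ^+ s * modulus P`_n <= modulus P`_0.
    have := @high_part_le n n rho P 0 _ sP' zf; rewrite lowE modulus0.
    rewrite horner_coef0 coef_binomial_poly add0n bin0 binn divr1 mulr1n.
    rewrite leqnn (leq_trans s0 (ltnW sn)) => /(_ isT rho0); apply: le_trans.
    by rewrite ler_wpM2r ?modulus_ge0// ler_weXn2l// ltnW.
  have Ps_le : rho ^+ s * modulus (P`_s / 'C(n, s)%:R) <= modulus P`_0.
    have := @high_part_le n s rho P 0 s0n sP' zf; rewrite lowE modulus0 => /(_ rho0).
    by rewrite horner_coef0 V0.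
  by rewrite mulrC; case: (leP (modulus P`_n)).
have Vns : (high_part n s P)`_(n - s) = P`_n.
  by rewrite coef_binomial_poly subnK ?(ltnW sn)// !binn divr1 mulr1n.
have sV : size (high_part n s P) = (n - s).+1.
  apply/eqP; rewrite eqn_leq size_binomial_poly/= ltnNge; apply/negP => sV.
  by move: Pn; rewrite -Vns nth_default ?eqxx.
(* Here s < n matters: V has positive degree n - s, so its end coefficients are distinct and
   [ends_le] applies to it. *)
have ns0 : (0 < n - s)%N by rewrite subn_gt0.
have := ends_le ns0 sV (ltW p0); rewrite Vns V0 => VP.
apply: le_trans (ler_wpM2r (pnorm_ge0 _ _) VP) _.
rewrite !pnormE// -powRM ?power_mean_ge0//.
rewrite ge0_ler_powR ?nnegrE ?mulr_ge0 ?power_mean_ge0 ?invr_ge0 ?(ltW p0)//.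
exact: low_high_power_mean.
Qed.

Lemma pnorm_comp_pow n p Q1 Q2 : (0 < n)%N ->
  (forall t : R, Q1.[expi t] = Q2.[expi t ^+ n]) -> pnorm p Q1 = pnorm p Q2.
Proof.
move=> n0 E.
have El : circle_mean (fun t => mlog Q1.[expi t]) =
    circle_mean (fun t => mlog Q2.[expi t]).
  rewrite -(@circle_mean_pow _ (fun z => mlog Q2.[z]) n n0).
    by apply: (congr1 (@circle_mean R)); apply/funext => t; rewrite E.
  exact: measurable_mlog_circle.
have Ep : circle_mean (fun t => (modulus Q1.[expi t] `^ p)%:E) =
    circle_mean (fun t => (modulus Q2.[expi t] `^ p)%:E).
  rewrite -(@circle_mean_pow _ (fun z => (modulus Q2.[z] `^ p)%:E) n n0).
    by apply: (congr1 (@circle_mean R)); apply/funext => t; rewrite E.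
  exact: modulus_pow_measurable.
rewrite /pnorm Ep; case: (p == 0) => //.
exact: (congr1 (fun x => fine (expeR x))).
Qed.

(** Circle means are invariant under z -> z^n; this gives the equality case, where P = a_n z^n +
    a_0. *)
Lemma pnorm_binomial n (a b : R[i]) p : (0 < n)%N ->
  pnorm p (a *: 'X^n + b%:P) = pnorm p (a *: 'X + b%:P).
Proof.
move=> n0; apply: (pnorm_comp_pow _ n0) => t.
by rewrite !hornerD !hornerZ hornerXn hornerX !hornerC.
Qed.

End Assembly.

Theorem theorem2p1 (R : realType) (n : nat) (rho : R) (P : {poly R[i]})
    (hn : (1 <= n)%N) (hrho : 1 <= rho) (hdeg : size P = n.+1)
    (hzero : forall z : R[i], modulus z < rho -> P.[z] != 0)
    (p : R) (hp : 0 <= p) (s : nat) (hs : (s < n)%N) :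
  let lhs := pnorm p (P`_n *: 'X + (P`_s / 'C(n, s)%:R)%:P) in
  let rhs := cst_c p s *
    (pnorm p (1 + 'X) / pnorm p ((real_complex R rho ^+ s)%:P + 'X)) *
    pnorm p P in
  lhs <= rhs /\
  ((forall j : nat, (1 <= j <= n.-1)%N -> P`_j = 0) -> s = 0%N -> lhs = rhs).
Proof.
have N0 : pnorm p (1 + 'X : {poly R[i]}) != 0.
  by rewrite gt_eqF// -polyC1 -(rmorph1 (real_complex R)) pnorm_addX_gt0.
rewrite /cst_c; case: (posnP s) => [->|s0] /=; last first.
  split; last by move=> _ se; rewrite se in s0.
  have rhos : 1 <= rho ^+ s by rewrite exprn_ege1.
  (* For s > 0 the constant c_p cancels the numerator ||1 + z||_p, leaving a product estimate. *)
  rewrite mulrA div1r mulVf// mul1r [leRHS]mulrC ler_pdivlMr.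
    by apply: low_high_pnorm; rewrite // s0.
  by rewrite -rmorphXn pnorm_addX_gt0.
(* For s = 0 the polynomial rho^s + z is 1 + z, so the quotient of norms is 1. *)
rewrite expr0 polyC1 divff// !mul1r bin0 divr1; split.
  exact: ends_le.
move=> hP _; rewrite -(pnorm_binomial _ _ _ hn); congr pnorm.
apply/polyP => j; rewrite coefD coefZ coefXn coefC.
have [->|j0] := posnP j; first by rewrite ltn_eqF// mulr0 add0r.
rewrite addr0; have [->|jn] := eqVneq j n; first by rewrite mulr1.
rewrite mulr0; have [jn'|jn'] := ltnP j n.
  by rewrite hP// j0 -ltnS prednK.
by rewrite nth_default// hdeg ltn_neqAle eq_sym jn.
Qed.
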